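(* Let $q\ge3$ be a prime power and $n\ge2$ an integer. For each integer $a$ with $2\le a\le q^{n-1}-1$, there exists a one-point AG code over $\mathbb{F}_{q^n}$ with parameters $$\left[q^{2n-1},\ \frac{a(a+1)}{2}+\sum_{i=1}^{a-1}\left\lfloor\frac{i(q^{n-1}-1)}{q^{n-1}(q-1)}\right\rfloor,\ q^{2n-1}-\frac{(a-1)(q^n-1)}{q-1}\right].$$
   Context: A code with parameters $[N,k,d]$ over a finite field $\mathbb{F}$ is a linear subspace of $\mathbb{F}^N$ of dimension $k$ whose minimum Hamming distance is exactly $d$. An (algebraic geometry) AG code over $\mathbb{F}$ is a code of the form $C_{\mathcal{L}}(D,G)=\{(f(P_1),\dots,f(P_N))\mid f\in\mathcal{L}(G)\}\subseteq\mathbb{F}^N$, where $F/\mathbb{F}$ is a function field with full constant field $\mathbb{F}$, $D=P_1+\dots+P_N$ is a sum of pairwise distinct rational (degree-one) places, $G$ is a divisor of $F$ with support disjoint from that of $D$, and $\mathcal{L}(G)=\{z\in F\mid(z)+G\ge0\}\cup\{0\}$. The code is one-point if the support of $G$ consists of a single rational place. $\lfloor\cdot\rfloor$ is the floor function. *)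

(* Defs.v *)
From HB Require Import structures.
From mathcomp Require Import all_boot all_order all_algebra.
From mathcomp Require Import boolp classical_sets cardinality.

Set Implicit Arguments.
Unset Strict Implicit.
Unset Printing Implicit Defensive.

Import Order.TTheory GRing.Theory Num.Theory.
Local Open Scope ring_scope.

Definition prime_power (q : nat) : Prop :=
  exists p e : nat, [/\ prime p, (0 < e)%N & q = (p ^ e)%N].

(** * Linear codes *)

Definition hamming_dist (K : finFieldType) (N : nat) (u v : 'rV[K]_N) : nat :=
  #|[set i : 'I_N | u 0 i != v 0 i]%SET|.

Definition min_distance (K : finFieldType) (N : nat)
    (C : {vspace 'rV[K]_N}) (d : nat) : Prop :=
  (exists u v : 'rV[K]_N,
     [/\ u \in C, v \in C, u != v & hamming_dist u v = d]) /\
  (forall u v : 'rV[K]_N,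
     u \in C -> v \in C -> u != v -> (d <= hamming_dist u v)%N).

Definition code_parameters (K : finFieldType) (N : nat)
    (C : {vspace 'rV[K]_N}) (k d : nat) : Prop :=
  \dim C = k /\ min_distance C d.

(** * Function fields in one variable *)

(** [y] lies in the subfield [K(x)] of [F], where [K] is embedded by [iota]. *)
Definition in_simple_ext (K F : fieldType) (iota : {rmorphism K -> F})
    (x y : F) : Prop :=
  exists p r : {poly K},
    (map_poly iota r).[x] != 0 /\
    y = (map_poly iota p).[x] / (map_poly iota r).[x].

(** [F] is a finite extension of [K(x)] for some [x] transcendental over [K]. *)
Definition function_field_axiom (K F : fieldType) (iota : {rmorphism K -> F}) :
    Prop :=
  exists x : F, ~ algebraicOver iota x /\
  exists (m : nat) (b : 'I_m -> F), forall z : F,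
  exists c : 'I_m -> F,
    (forall i, in_simple_ext iota x (c i)) /\ z = \sum_(i < m) c i * b i.

Record functionField (K : finFieldType) := FunctionField {
  ff_sort :> fieldType;
  ff_const : {rmorphism K -> ff_sort};
  ff_axiom : function_field_axiom ff_const;
  ff_full_constants :
    forall z : ff_sort, algebraicOver ff_const z -> exists c : K, z = ff_const c
}.

(** * Places *)

(** A place is the maximal ideal of a valuation ring of [F/K], that is, of a
    ring [K < O < F] (both inclusions strict) containing [z] or [z^-1] for every
    [z] in [F].  Ideal and ring determine each other; the record stores the
    ring, and [place_ideal] below is the place itself. *)
Record place (K : finFieldType) (F : functionField K) := Place {
  place_ring : {pred F};
  place_ring_subring : subring_closed place_ring;
  place_ring_const : forall c : K, ff_const F c \in place_ring;
  place_ring_neq_const :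
    exists2 z : F, z \in place_ring & forall c : K, z != ff_const F c;
  place_ring_proper : exists z : F, z \notin place_ring;
  place_ring_val : forall z : F, z \in place_ring \/ z^-1 \in place_ring
}.

(** The test [z == 0] is needed because [0^-1 = 0] in MathComp. *)
Definition place_unit (K : finFieldType) (F : functionField K) (P : place F) :
    {pred F} :=
  [pred z | [&& z \in place_ring P, z != 0 & z^-1 \in place_ring P]].

Definition place_ideal (K : finFieldType) (F : functionField K) (P : place F) :
    {pred F} :=
  [pred z | (z \in place_ring P) && (z \notin place_unit P)].

Definition prime_element (K : finFieldType) (F : functionField K)
    (P : place F) (t : F) : Prop :=
  forall z : F,
    z \in place_ideal P <-> exists2 y : F, y \in place_ring P & z = t * y.

(** [v_P(z)] is the integer [m] with [z = t ^ m * u], for a prime element [t]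
    and a unit [u] of the valuation ring; such an [m] exists and is unique for
    every [z != 0].  The value at [0], where [v_P] is infinite, is irrelevant:
    it is never used. *)
Definition valuation (K : finFieldType) (F : functionField K) (P : place F)
    (z : F) : int :=
  xget 0 [set m : int | exists t u : F,
    [/\ prime_element P t, u \in place_unit P & z = t ^ m * u]]%classic.

(** [d] is the dimension over [K] of the residue field of [P]: the residue
    classes of [b_0, ..., b_(d-1)] form a [K]-basis of it. *)
Definition place_degree (K : finFieldType) (F : functionField K) (P : place F)
    (d : nat) : Prop :=
  exists b : 'I_d -> F, (forall i, b i \in place_ring P) /\
  forall z : F, z \in place_ring P ->
    exists! c : {ffun 'I_d -> K},
      z - \sum_(i < d) ff_const F (c i) * b i \in place_ideal P.

Definition rational_place (K : finFieldType) (F : functionField K)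
    (P : place F) : Prop :=
  place_degree P 1.

(** The residue class [f(P)], as an element of [K]; meaningful for [P] rational
    and [f] in the valuation ring of [P]. *)
Definition place_eval (K : finFieldType) (F : functionField K) (P : place F)
    (f : F) : K :=
  odflt 0 [pick c : K | f - ff_const F c \in place_ideal P].

(** * Divisors and algebraic geometry codes *)

Record divisor (K : finFieldType) (F : functionField K) := Divisor {
  divisor_coef :> place F -> int;
  divisor_finite : finite_set [set P | divisor_coef P != 0]%classic
}.

Definition divisor_support (K : finFieldType) (F : functionField K)
    (G : divisor F) : set (place F) :=
  [set P | G P != 0]%classic.

Definition riemann_roch_space (K : finFieldType) (F : functionField K)
    (G : divisor F) : set F :=
  [set z : F | z = 0 \/ forall P : place F, 0 <= valuation P z + G P]%classic.

(** [C = C_L(D, G)] with [D = P_0 + ... + P_(N-1)]. *)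
Definition is_AG_code_of (K : finFieldType) (F : functionField K) (N : nat)
    (P : 'I_N -> place F) (G : divisor F) (C : {vspace 'rV[K]_N}) : Prop :=
  [/\ injective P,
      forall i, rational_place (P i),
      forall i, ~ divisor_support G (P i) &
      forall w : 'rV[K]_N, w \in C <->
        exists2 f : F, riemann_roch_space G f
                     & w = \row_(i < N) place_eval (P i) f].

Definition one_point_divisor (K : finFieldType) (F : functionField K)
    (G : divisor F) : Prop :=
  exists2 Q : place F, rational_place Q & divisor_support G = [set Q]%classic.

Definition one_point_AG_code (K : finFieldType) (N : nat)
    (C : {vspace 'rV[K]_N}) : Prop :=
  exists (F : functionField K) (P : 'I_N -> place F) (G : divisor F),
    one_point_divisor G /\ is_AG_code_of P G C.

(* Main.v *)
Require Import Defs.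
From HB Require Import structures.
From mathcomp Require Import all_boot all_order all_algebra.
From mathcomp Require Import generic_quotient fieldext.
From mathcomp Require Import boolp classical_sets cardinality.
From mathcomp Require Import zify.

(** The code comes from the norm-trace curve [Tr y = N x] over the field [K] with [q ^ n]
    elements, where [Tr y] is the sum of the [y ^ (q ^ j)] for [j < n] and [N x = x ^ M] with
    [M = (q ^ n - 1) / (q - 1)].  Put [Q = q ^ (n - 1)].  At the only place at infinity
    [x] and [y] have poles of the coprime orders [Q] and [M], and there are [Q] rational
    points above each value of [x] in [K], so [q ^ (2 n - 1)] in all
    ([card_curve_points]).  The code evaluates at these points the functions whose
    only pole is at infinity, of order at most [m = (a - 1) M].

    Pole orders at infinity are modelled by weights: [x ^ i y ^ j] has weight [i Q + j M],
    and these weights are distinct for [j < Q].  Leading forms with respect to the weight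
    are multiplicative and vanish on the curve polynomial ([lead_form_curve]), which
    yields at once that the curve polynomial is irreducible, so that there is a
    function field ([norm_trace_function_field]), and that the weight is a discrete
    valuation; its place is the only one where [x] has a pole
    ([infinity_place_exists]).

    The curve is smooth above the affine line because the trace polynomial has derivative
    [1].  This is used in the following form: at a point with coordinates fixed by
    [u |-> u ^ s], the function [x ^ s - x] is a uniformizer ([vanishing_step]).  The
    resulting places ([affine_place_exists]), taken over all finite extensions of [K],
    show that a function without affine poles is a polynomial in [x] and [y]
    ([affine_regular]).  So the functions to be evaluated have the basis
    [x ^ i y ^ j] with [j < Q] and [i Q + j M <= m].  The number of these monomials is the
    dimension ([card_monomials_weight], [sum_floor_weights]), as soon as evaluation is
    injective.

    A function of weight [m] has at most [m] rational zeros ([zeros_le_weight]); since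
    [m < q ^ (2 n - 1)], evaluation is injective and the minimum distance is at least
    [q ^ (2 n - 1) - m].  The product of [a - 1] functions [y - c] with [Tr c != 0] has
    exactly [m] zeros ([extremal_poly]), hence equality. *)

Set Implicit Arguments.
Unset Strict Implicit.
Unset Printing Implicit Defensive.

Import Order.TTheory GRing.Theory Num.Theory.
Local Open Scope ring_scope.

(** * The norm-trace polynomial and substitutions *)

(** On a field with [q ^ n] elements this is the trace to the subfield with [q]
    elements, and [u ^+ trace_exp q n] is the norm. *)
Definition trace_pow (q n : nat) (S : nzRingType) (u : S) : S :=
  \sum_(j < n) u ^+ (q ^ j).

Definition trace_exp (q n : nat) : nat := \sum_(j < n) q ^ j.

(** The outer variable is [y] and the inner one is [x], so that this polynomial
    is monic of degree [q ^ n.-1] and division by it is available. *)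
Definition curve_poly (K : fieldType) (q n : nat) : {poly {poly K}} :=
  trace_pow q n 'X - ('X^(trace_exp q n))%:P.

Definition eval2 (K : fieldType) (S : comNzRingType) (g : {rmorphism K -> S})
    (x y : S) : {poly {poly K}} -> S :=
  horner_eval y \o map_poly (horner_eval x \o map_poly g).

HB.instance Definition _ (K : fieldType) (S : comNzRingType)
    (g : {rmorphism K -> S}) (x y : S) :=
  GRing.RMorphism.copy (eval2 g x y)
    (horner_eval y \o map_poly (horner_eval x \o map_poly g)).

Section Eval2.
Variables (K : fieldType) (S : comNzRingType) (g : {rmorphism K -> S}) (x y : S).

Lemma eval2C (p : {poly K}) : eval2 g x y p%:P = (map_poly g p).[x].
Proof. by rewrite /eval2 /= map_polyC /= /horner_eval hornerC. Qed.

Lemma eval2CC (c : K) : eval2 g x y c%:P%:P = g c.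
Proof. by rewrite eval2C map_polyC hornerC. Qed.

Lemma eval2CX : eval2 g x y 'X%:P = x.
Proof. by rewrite eval2C map_polyX hornerX. Qed.

Lemma eval2X : eval2 g x y 'X = y.
Proof. by rewrite /eval2 /= map_polyX /horner_eval hornerX. Qed.

Lemma eval2E (a : {poly {poly K}}) :
  eval2 g x y a = \sum_(j < size a) (map_poly g a`_j).[x] * y ^+ j.
Proof.
rewrite -{1}[a]coefK poly_def rmorph_sum /=; apply: eq_bigr => j _.
by rewrite -mul_polyC rmorphM rmorphXn /= eval2C eval2X.
Qed.

Lemma eval2B a b : eval2 g x y (a - b) = eval2 g x y a - eval2 g x y b.
Proof. exact: (rmorphB (eval2 g x y : {rmorphism {poly {poly K}} -> S})). Qed.

Lemma eval2D a b : eval2 g x y (a + b) = eval2 g x y a + eval2 g x y b.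
Proof. exact: (rmorphD (eval2 g x y : {rmorphism {poly {poly K}} -> S})). Qed.

Lemma eval2N a : eval2 g x y (- a) = - eval2 g x y a.
Proof. exact: (rmorphN (eval2 g x y : {rmorphism {poly {poly K}} -> S})). Qed.

Lemma eval2M a b : eval2 g x y (a * b) = eval2 g x y a * eval2 g x y b.
Proof. exact: (rmorphM (eval2 g x y : {rmorphism {poly {poly K}} -> S})). Qed.

Lemma eval2Xn a m : eval2 g x y (a ^+ m) = eval2 g x y a ^+ m.
Proof. exact: (rmorphXn (eval2 g x y : {rmorphism {poly {poly K}} -> S})). Qed.

Lemma eval2_0 : eval2 g x y 0 = 0.
Proof. exact: (rmorph0 (eval2 g x y : {rmorphism {poly {poly K}} -> S})). Qed.

Lemma eval2_1 : eval2 g x y 1 = 1.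
Proof. exact: (rmorph1 (eval2 g x y : {rmorphism {poly {poly K}} -> S})). Qed.

Lemma eval2_sum (I : Type) (r : seq I) (P : pred I) f :
  eval2 g x y (\sum_(i <- r | P i) f i) = \sum_(i <- r | P i) eval2 g x y (f i).
Proof. exact: (rmorph_sum (eval2 g x y : {rmorphism {poly {poly K}} -> S})). Qed.
End Eval2.

Lemma rmorph_trace_pow (q n : nat) (S S' : nzRingType) (f : {rmorphism S -> S'}) u :
  f (trace_pow q n u) = trace_pow q n (f u).
Proof. by rewrite rmorph_sum; apply: eq_bigr => j _; rewrite rmorphXn. Qed.

Lemma eval2_trace (K : fieldType) q n (S : comNzRingType) (g : {rmorphism K -> S})
    (x y : S) a : eval2 g x y (trace_pow q n a) = trace_pow q n (eval2 g x y a).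
Proof. exact: (rmorph_trace_pow _ _ (eval2 g x y : {rmorphism {poly {poly K}} -> S})). Qed.

Lemma eval2_curve (K : fieldType) q n (S : comNzRingType) (g : {rmorphism K -> S}) (x y : S) :
  eval2 g x y (curve_poly K q n) = trace_pow q n y - x ^+ trace_exp q n.
Proof.
by rewrite eval2B eval2_trace eval2X eval2C map_polyXn hornerXn.
Qed.

(** * Weights and leading forms *)

Section Weight.
Variables (K : fieldType) (q n : nat).
Hypotheses (q_gt1 : (1 < q)%N) (n_gt1 : (1 < n)%N).

Local Notation R := {poly {poly K}}.
Local Notation Q := (q ^ n.-1)%N.
Local Notation M := (trace_exp q n).
Local Notation h := (curve_poly K q n).

Lemma trace_exp_mul : (M * (q - 1) = q ^ n - 1)%N.
Proof. by rewrite mulnC !subn1 -predn_exp. Qed.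

Lemma trace_exp_gt0 : (0 < M)%N.
Proof.
by rewrite /trace_exp (bigD1 (Ordinal (ltnW n_gt1))) //= expn0 addSn.
Qed.

(** Every term of [trace_exp q n] but the first is divisible by [q]. *)
Lemma coprime_weights : coprime Q M.
Proof.
apply: coprimeXl; rewrite /trace_exp.
case: n n_gt1 => // n' _; rewrite big_ord_recl expn0.
under eq_bigr do rewrite /= /bump /= add1n expnS.
by rewrite -big_distrr /= /coprime addnC mulnC gcdnMDl gcdn1.
Qed.

(** Sends [x] to [x tau ^ Q] and [y] to [tau ^ M]: the exponent of [tau] records
    the weight, which is going to be the pole order at infinity.  Keeping [x] makes
    the map injective, so that weights add up because degrees in [tau] do. *)
Definition weight_map : R -> R :=
  eval2 (polyC \o polyC) ('X%:P * 'X^Q) ('X^M).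

HB.instance Definition _ := GRing.RMorphism.on weight_map.

Lemma coef_weight_map (a : R) s i :
  (weight_map a)`_s`_i = \sum_(j < size a | (i * Q + j * M == s)%N) a`_j`_i.
Proof.
rewrite /weight_map eval2E !coef_sum [RHS]big_mkcond /=; apply: eq_bigr => j _.
rewrite horner_coef size_map_poly mulr_suml !coef_sum.
transitivity (\sum_(k < size a`_j | (k == i :> nat) && (k * Q + j * M == s)%N)
  a`_j`_k).
  rewrite [RHS]big_mkcond; apply: eq_bigr => k _.
  rewrite coef_map /= exprMn -!exprM -polyC_exp [X in X * _]mulrA -polyCM -mulrA.
  rewrite -exprD coefCM coefXn mulr_natr mulrb.
  rewrite [(Q * k)%N]mulnC [(M * j)%N]mulnC [s == _]eq_sym.
  case: (boolP (_ == s)); rewrite ?andbF ?coef0 // andbT => _.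
  by rewrite coefCM coefXn mulr_natr mulrb eq_sym.
have [lti|] := ltnP i (size a`_j).
  rewrite (eq_bigl (fun k : 'I__ => (k == Ordinal lti) && (i * Q + j * M == s)%N)).
    by case: ifP => _; [under eq_bigl do rewrite andbT; rewrite big_pred1_eq
                       | rewrite big1 // => k; rewrite andbF].
  by move=> k; rewrite -val_eqE /=; case: eqP => //= ->.
move=> lei; rewrite big1 => [|k /andP[/eqP ki _]]; first by rewrite nth_default ?if_same.
by move: (ltn_ord k); rewrite ki ltnNge lei.
Qed.

Lemma coef_weight_map_self (a : R) i j :
  (weight_map a)`_(i * Q + j * M)`_i = a`_j`_i.
Proof.
rewrite coef_weight_map.
under eq_bigl => k do rewrite eqn_add2l eqn_pmul2r ?trace_exp_gt0 //.
have [ltj|lej] := ltnP j (size a).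
  by rewrite (big_pred1 (Ordinal ltj)) // => k; rewrite -val_eqE.
rewrite big1 ?[a`_j]nth_default ?coef0 // => k /eqP kj.
by move: (ltn_ord k); rewrite kj ltnNge lej.
Qed.

Lemma weight_map_inj : injective weight_map.
Proof.
move=> a b eqab; apply/polyP => j; apply/polyP => i.
by rewrite -[LHS]coef_weight_map_self eqab coef_weight_map_self.
Qed.

(** All monomials of [a] have weight at most [m]. *)
Definition weight_le (m : nat) (a : R) : Prop := (size (weight_map a) <= m.+1)%N.
(** The part of weight [m] with [x = y = 1].  On the monomials of weight [m], which
    all have the same leading behaviour at infinity, this is the leading coefficient
    of the Laurent expansion there. *)
Definition lead_form (m : nat) (a : R) : K := ((weight_map a)`_m).[1].
Arguments weight_le m%_N a%_R.
Arguments lead_form m%_N a%_R.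

Lemma weight_leP m a :
  weight_le m a <-> (forall i j, a`_j`_i != 0 -> (i * Q + j * M <= m)%N).
Proof.
split=> [le_am i j|le_am].
  rewrite -coef_weight_map_self; apply: contraNT; rewrite -ltnNge => lt_m.
  by rewrite [(weight_map a)`_ _]nth_default ?coef0 // (leq_trans le_am).
apply/leq_sizeP => s lt_ms; apply/polyP => i; rewrite coef_weight_map coef0.
apply: big1 => j /eqP js; apply/eqP; apply: contraTT lt_ms => /le_am.
by rewrite js -ltnNge.
Qed.

Lemma weight_leB m a b : weight_le m a -> weight_le m b -> weight_le m (a - b).
Proof.
by move=> la lb; rewrite /weight_le rmorphB (leq_trans (size_polyD _ _)) // size_polyN geq_max la.
Qed.

Lemma weight_le0 m : weight_le m 0.
Proof. by rewrite /weight_le rmorph0 size_poly0. Qed.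

Lemma weight_leD m a b : weight_le m a -> weight_le m b -> weight_le m (a + b).
Proof.
by move=> la lb; rewrite /weight_le rmorphD (leq_trans (size_polyD _ _)) // geq_max la.
Qed.

Lemma weight_leM m l a b :
  weight_le m a -> weight_le l b -> weight_le (m + l) (a * b).
Proof.
move=> la lb; rewrite /weight_le rmorphM /= (leq_trans (size_polyMleq _ _)) //.
have le_sum A B : (A <= m.+1 -> B <= l.+1 -> (A + B).-1 <= (m + l).+1)%N by clear; lia.
exact: le_sum.
Qed.

Lemma weight_le_const (c : K) : weight_le 0 c%:P%:P.
Proof. by rewrite /weight_le /weight_map eval2CC /= size_polyC leq_b1. Qed.

Lemma lead_formB m a b : lead_form m (a - b) = lead_form m a - lead_form m b.
Proof. by rewrite /lead_form rmorphB coefB hornerD hornerN. Qed.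

Lemma lead_formM m l a b : weight_le m a -> weight_le l b ->
  lead_form (m + l) (a * b) = lead_form m a * lead_form l b.
Proof.
move=> la lb; rewrite /lead_form rmorphM /= coefM.
have ltm : (m < (m + l).+1)%N by rewrite ltnS leq_addr.
rewrite (bigD1 (Ordinal ltm)) //= addKn big1 ?addr0 ?hornerM // => i nei.
have [lti|lei] := ltnP m i; first by rewrite nth_default ?mul0r // (leq_trans la).
rewrite [X in _ * X]nth_default ?mulr0 // (leq_trans lb) //.
move: nei; rewrite -val_eqE /=; move: lei; clear; lia.
Qed.

Lemma lead_form_const (c : K) : lead_form 0 c%:P%:P = c.
Proof. by rewrite /lead_form /weight_map eval2CC /= coefC hornerC. Qed.

Lemma lead_form_small m l a : (l < m)%N -> weight_le l a -> lead_form m a = 0.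
Proof.
by move=> lm la; rewrite /lead_form nth_default ?horner0 // (leq_trans la).
Qed.

Lemma weight_le_trans m l a : (l <= m)%N -> weight_le l a -> weight_le m a.
Proof. by move=> lm la; rewrite /weight_le (leq_trans la). Qed.

Lemma weight_monomial i j :
  weight_le (i * Q + j * M) (('X^i)%:P * 'X^j) /\
  lead_form (i * Q + j * M) (('X^i)%:P * 'X^j) = 1.
Proof.
rewrite /weight_le /lead_form rmorphM polyC_exp !rmorphXn /= /weight_map.
rewrite eval2CX eval2X exprMn -!exprM -mulrA -exprD -polyC_exp.
rewrite [(Q * i)%N]mulnC [(M * j)%N]mulnC; split.
  by rewrite size_Cmul ?size_polyXn // -size_poly_eq0 size_polyXn.
by rewrite coefCM coefXn eqxx mulr1 hornerXn expr1n.
Qed.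

Lemma weight_map_curve :
  weight_map h = trace_pow q n 'X^M - ('X^M)%:P * 'X^(Q * M).
Proof.
by rewrite /weight_map eval2_curve exprMn -exprM polyC_exp.
Qed.

(** The two monomials [y ^ Q] and [x ^ M] of weight [Q * M] have opposite
    coefficients; every other monomial is lighter. *)
Lemma weight_curve : size (weight_map h) = (Q * M).+1 /\ lead_form (Q * M) h = 0.
Proof.
have E : weight_map h = (1 - 'X^M)%:P * 'X^(Q * M) + \sum_(j < n.-1) 'X^(M * q ^ j).
  rewrite weight_map_curve /trace_pow.
  case: n n_gt1 => // n' _ /=; rewrite big_ord_recr /=.
  under eq_bigr => j _ do rewrite -exprM.
  by rewrite -exprM mulnC polyCB polyC1 mulrBl mul1r -addrA addrC.
have nz : (1 - 'X^M : {poly K}) != 0.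
  by rewrite -opprB oppr_eq0 -size_poly_eq0 size_XnsubC ?trace_exp_gt0.
have szS : (size (\sum_(j < n.-1) ('X^(M * q ^ j) : R))%R < (Q * M).+1)%N.
  rewrite ltnS; apply: (leq_trans (size_sum _ _ _)); apply/bigmax_leqP => j _.
  by have := ltn_ord j; rewrite size_polyXn [(Q * M)%N]mulnC ltn_mul2l trace_exp_gt0 ltn_exp2l.
have szL : size ((1 - 'X^M)%:P * 'X^(Q * M) : R) = (Q * M).+1.
  by rewrite size_Cmul // size_polyXn.
split; first by rewrite E size_polyDl szL.
rewrite /lead_form E coefD [X in _ + X]nth_default // addr0 coefCM coefXn eqxx mulr1.
by rewrite !hornerE expr1n subrr.
Qed.

(** A multiple of the curve polynomial has a leading form divisible by that of the
    curve polynomial, which is zero; this makes leading forms well defined on the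
    coordinate ring of the curve. *)
Lemma lead_form_curve m a c : weight_le m a -> a = c * h -> lead_form m a = 0.
Proof.
have [szh lh] := weight_curve.
move=> la eqa; have [c0|nzc] := eqVneq c 0.
  by rewrite eqa c0 mul0r /lead_form rmorph0 coef0 horner0.
have nzP : weight_map c != 0 by rewrite -(rmorph0 weight_map) (inj_eq weight_map_inj).
have : size (weight_map a) = (size (weight_map c) + Q * M)%N.
  by rewrite eqa rmorphM /= size_mul // -?size_poly_eq0 szh // addnS.
move: la; rewrite /weight_le => /[swap] -> le_m.
have lQM : (Q * M <= m)%N.
  by move: le_m; rewrite -size_poly_eq0 in nzP; move: nzP; lia.
have lc : weight_le (m - Q * M) c by rewrite /weight_le; lia.
rewrite eqa -(subnK lQM) lead_formM ?lh ?mulr0 //.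
by rewrite /weight_le szh.
Qed.

(** As the weights [Q] and [M] are coprime, the exponent of [y], if below [Q], can be
    read off the weight modulo [Q]. *)
Lemma weight_uniq i j i' j' : (j' < Q)%N -> (j <= j')%N ->
  (i * Q + j * M = i' * Q + j' * M)%N -> j = j'.
Proof.
move=> ltj' lejj' eij; apply/eqP; rewrite eqn_leq lejj' -subn_eq0 /=.
have : (Q %| j' - j)%N.
  rewrite -(Gauss_dvdl _ coprime_weights); apply/dvdnP; exists (i - i')%N.
  by rewrite !mulnBl; lia.
by apply: contraTT; rewrite -lt0n => j0; rewrite gtnNdvd // (leq_ltn_trans (leq_subr _ _)).
Qed.

(** No cancellation is possible: by [weight_uniq] a reduced polynomial has at most one
    monomial of each weight. *)
Lemma reduced_lead_form (a : R) : (size a <= Q)%N -> a != 0 ->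
  exists m, weight_le m a /\ lead_form m a != 0.
Proof.
move=> sza nza.
have nzP : weight_map a != 0 by rewrite -(rmorph0 weight_map) (inj_eq weight_map_inj).
exists (size (weight_map a)).-1; rewrite /weight_le prednK ?size_poly_gt0 //.
split => //; rewrite /lead_form -lead_coefE.
have := nzP; rewrite -lead_coef_eq0; set p := lead_coef _ => nzp.
(* The top coefficient in [tau] is a polynomial in [x] with a single monomial. *)
have one i k : p`_i != 0 -> p`_k != 0 -> i = k.
  have ex l : p`_l != 0 -> exists2 j, (j < Q)%N &
      (l * Q + j * M = (size (weight_map a)).-1)%N.
    move=> nzl; have /existsP[j /eqP jE] : [exists j : 'I_(size a),
        (l * Q + j * M == (size (weight_map a)).-1)%N].
      apply: contraNT nzl => /existsPn no; rewrite /p lead_coefE coef_weight_map.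
      by rewrite big_pred0 // => j; apply/negbTE.
    by exists j => //; apply: leq_trans sza.
  move=> /ex[j ltj ij] /ex[j' ltj' ij'].
  have ejj : j = j'.
    have [jj|/ltnW jj] := leqP j j'.
      exact: (weight_uniq ltj' jj (etrans ij (esym ij'))).
    exact/esym/(weight_uniq ltj jj (etrans ij' (esym ij))).
  move: ij; rewrite -ij' ejj => /eqP; rewrite eqn_add2r eqn_pmul2r => [/eqP //|].
  by apply: leq_ltn_trans ltj'.
have pE : p = lead_coef p *: 'X^((size p).-1).
  apply/polyP => i; rewrite coefZ coefXn; case: eqP => [->|nei].
    by rewrite mulr1 lead_coefE.
  rewrite mulr0; apply/eqP; apply: contra_notT nei => nzi.
  by apply: one => //; rewrite -lead_coefE lead_coef_eq0.
by rewrite pE hornerZ hornerXn expr1n mulr1 lead_coef_eq0.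
Qed.
End Weight.

(** * The function field of the curve *)

Lemma fraction_numden (D : idomainType) (z : {fraction D}) :
  exists a b : D, b != 0 /\ z = tofrac a / tofrac b.
Proof.
exists (\n_(repr z)), (\d_(repr z)); split; first exact: denom_ratioP.
have nz : tofrac \d_(repr z) != 0 by rewrite tofrac_eq0 denom_ratioP.
apply: (mulIf nz); rewrite divfK // -{1}(reprK z); move: (repr z) => {nz} r.
unlock FracField.tofrac; rewrite -[LHS]FracField.pi_mul; apply/eqmodP.
rewrite /= FracField.equivfE /FracField.mulf.
by rewrite !numden_Ratio ?mulr1 ?mul1r ?mulf_neq0 ?oner_neq0 ?denom_ratioP // mulrC.
Qed.

Lemma clear_denominators (D : idomainType) (p : {poly {fraction D}}) :
  exists (r : D) (a : {poly D}),
    [/\ r != 0, size a = size p & tofrac r *: p = map_poly (@FracField.tofrac D) a].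
Proof.
have [r [a [nzr eqa]]] : exists (r : D) (a : {poly D}),
    r != 0 /\ tofrac r *: p = map_poly (@FracField.tofrac D) a.
  elim/poly_ind: p => [|p c [r [a [nzr eqa]]]].
    by exists 1, 0; rewrite oner_neq0 scaler0 rmorph0.
  have [u [v [nzv ->]]] := fraction_numden c.
  exists (r * v), (v%:P * a * 'X + (u * r)%:P); split; first by rewrite mulf_neq0.
  rewrite rmorphD !rmorphM /= !map_polyC /= map_polyX -eqa scalerDr.
  rewrite -!mul_polyC !rmorphM /=; congr (_ + _).
    by rewrite [X in X * _ = _]mulrC !mulrA.
  rewrite -!polyCM; congr (_%:P); rewrite -mulrA [tofrac v * _]mulrC divfK ?tofrac_eq0 //.
  by rewrite mulrC.
exists r, a; split => //.
have -> : size a = size (map_poly (@FracField.tofrac D) a).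
  by rewrite size_map_inj_poly ?rmorph0 // => x y /eqP; rewrite tofrac_eq => /eqP.
by rewrite -eqa size_scale ?tofrac_eq0.
Qed.

(** Gauss' argument: a factorization over the fraction field becomes, after clearing
    denominators, a product of two polynomials of smaller degree that is a multiple
    of [p]. *)
Lemma irreducible_fraction (D : idomainType) (p : {poly D}) :
  (1 < size p)%N ->
  (forall a b c : {poly D}, (size a < size p)%N -> (size b < size p)%N ->
     a != 0 -> b != 0 -> a * b <> c * p) ->
  irreducible_poly (map_poly (@FracField.tofrac D) p).
Proof.
move=> sz1p no_factor.
have injF : injective (@FracField.tofrac D).
  by move=> x y /eqP; rewrite tofrac_eq => /eqP.
have szpF : size (map_poly (@FracField.tofrac D) p) = size p.
  by rewrite size_map_inj_poly ?rmorph0.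
split=> [|u sz1u /Pdiv.Field.dvdpP[v pE]]; first by rewrite szpF.
have nzp : map_poly (@FracField.tofrac D) p != 0.
  by rewrite -size_poly_eq0 szpF -lt0n ltnW.
have nzu : u != 0 by apply: contraNneq nzp => u0; rewrite pE u0 mulr0.
have nzv : v != 0 by apply: contraNneq nzp => v0; rewrite pE v0 mul0r.
have szuv : (size v + size u).-1 = size p by rewrite -size_mul // -pE szpF.
have [le_pu|lt_up] := leqP (size p) (size u).
  rewrite -dvdp_size_eqp ?szpF; last by rewrite pE dvdp_mull.
  have ar A B C : ((A + B).-1 = C -> A != 0 -> C <= B -> B == C)%N by clear; lia.
  by rewrite (ar _ _ _ szuv) ?size_poly_eq0.
have [r [a [nzr sza eqa]]] := clear_denominators u.
have [r' [b [nzr' szb eqb]]] := clear_denominators v.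
have [] := no_factor b a (r' * r)%:P.
- rewrite szb; have ar A B C : ((A + B).-1 = C -> B != 1 -> B != 0 -> A < C)%N.
    by clear; lia.
  by apply: ar szuv sz1u _; rewrite size_poly_eq0.
- by rewrite sza.
- by rewrite -size_poly_eq0 szb size_poly_eq0.
- by rewrite -size_poly_eq0 sza size_poly_eq0.
have E : map_poly (@FracField.tofrac D) (b * a) =
    map_poly (@FracField.tofrac D) ((r' * r)%:P * p).
  by rewrite !rmorphM /= !map_polyC /= pE -eqa -eqb -!mul_polyC mulrACA.
by apply: (map_inj_poly injF _ E); rewrite rmorph0.
Qed.

Section CurveField.
Variables (K : fieldType) (q n : nat).
Hypotheses (q_gt1 : (1 < q)%N) (n_gt1 : (1 < n)%N).

Local Notation R := {poly {poly K}}.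
Local Notation Q := (q ^ n.-1)%N.
Local Notation M := (trace_exp q n).
Local Notation h := (curve_poly K q n).

Lemma expQ_gt1 : (1 < Q)%N.
Proof. by rewrite -{1}(expn0 q) ltn_exp2l // -ltnS prednK // ltnW. Qed.

Lemma curve_size_monic : size h = Q.+1 /\ h \is monic.
Proof.
have [d [szd hE]] : exists d : R, (size d <= Q)%N /\ h = 'X^Q + d.
  exists (\sum_(j < n.-1) 'X^(q ^ j) - ('X^M)%:P); split; last first.
    by rewrite /curve_poly /trace_pow; case: n n_gt1 => // n' _;
      rewrite big_ord_recr /= addrA [_ + 'X^_]addrC.
  rewrite (leq_trans (size_polyD _ _)) // geq_max size_polyN.
  rewrite (leq_trans (size_polyC_leq1 _)) ?(ltnW expQ_gt1) // andbT.
  apply: (leq_trans (size_sum _ _ _)); apply/bigmax_leqP => j _.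
  by have := ltn_ord j; rewrite size_polyXn ltn_exp2l.
have szh : size h = Q.+1 by rewrite hE size_polyDl ?size_polyXn.
split=> //; rewrite monicE lead_coefE szh /= hE coefD coefXn eqxx nth_default //.
by rewrite addr0.
Qed.

(** The leading form of [a * b] is the product of two nonzero leading forms, while a
    multiple of the curve polynomial has leading form zero. *)
Lemma reduced_mul_neq (a b c : R) : (size a <= Q)%N -> (size b <= Q)%N ->
  a != 0 -> b != 0 -> a * b <> c * h.
Proof.
move=> sza szb nza nzb eqab.
have [m [am lam]] := reduced_lead_form q_gt1 n_gt1 sza nza.
have [l [bl lbl]] := reduced_lead_form q_gt1 n_gt1 szb nzb.
have := weight_leM am bl; move/(lead_form_curve q_gt1 n_gt1)/(_ eqab).
by rewrite lead_formM //; apply/eqP; rewrite mulf_neq0.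
Qed.

(** By [reduced_mul_neq] the coordinate ring has no zero divisors, which is all that
    [irreducible_fraction] asks for. *)
Lemma curve_irreducible :
  irreducible_poly (map_poly (@FracField.tofrac {poly K}) h).
Proof.
have [szh monh] := curve_size_monic.
apply: irreducible_fraction => [|a b c]; rewrite szh !ltnS.
  by rewrite ltnW // expQ_gt1.
exact: reduced_mul_neq.
Qed.

Lemma curve_reduce (a : R) : exists2 b : R, (size b <= Q)%N & exists c, a = c * h + b.
Proof.
have [szh monh] := curve_size_monic; exists (Pdiv.Ring.rmodp a h).
  by rewrite -ltnS -szh Pdiv.Ring.ltn_rmodpN0 // monic_neq0.
by exists (Pdiv.Ring.rdivp a h); apply: Pdiv.RingMonic.rdivp_eq.
Qed.

(** The field [K(x)[y]], obtained by adjoining a root of the curve polynomial to [K(x)]. *)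
Lemma curve_field_exists : exists (F : fieldType) (x y : F) (g : {rmorphism K -> F}),
  let ev := eval2 g x y in
  [/\ ev h = 0, forall a, ev a = 0 -> exists c, a = c * h
    & forall z, exists (a : R) (r : {poly K}), r != 0 /\ z = ev a / ev r%:P].
Proof.
have [L _ [y rooty fully]] := irredp_FAdjoin curve_irreducible.
pose E := {fraction {poly K}}.
pose to := @FracField.tofrac {poly K}.
pose g : {rmorphism K -> L} := in_alg L \o to \o polyC.
pose x : L := in_alg L (to 'X).
exists L, x, y, g => ev.
have evC p : ev p%:P = in_alg L (to p).
  pose f : {rmorphism {poly K} -> L} := in_alg L \o to.
  have := horner_map f (map_poly polyC p) 'X.
  by rewrite -map_poly_comp -/(p \Po 'X) comp_polyXr /ev eval2C.
have evE a : ev a = (map_poly (in_alg L) (map_poly to a)).[y].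
  rewrite -map_poly_comp /ev /eval2 /= /horner_eval; congr (_.[y]).
  by apply: eq_map_poly => p; rewrite -[RHS]evC /ev eval2C.
have injF : injective to by move=> u v /eqP; rewrite tofrac_eq => /eqP.
have ev_h : ev h = 0 by rewrite evE; apply/rootP.
have [szh monh] := curve_size_monic.
split=> // [a eva|z].
  have [b szb [c aE]] := curve_reduce a.
  suff b0 : b = 0 by exists c; rewrite aE b0 addr0.
  have : ev b = 0.
    move: eva ev_h; rewrite /ev aE rmorphD rmorphM /= => + h0.
    by rewrite h0 mulr0 add0r.
  rewrite evE => rootb; apply/eqP; apply: contraT => nzb.
  have szF (p : R) : size (map_poly to p) = size p by rewrite size_map_inj_poly ?rmorph0.
  have [cop|ncop] := boolP (coprimep (map_poly to h) (map_poly to b)).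
    have : coprimep (map_poly (in_alg L) (map_poly to h)) (map_poly (in_alg L) (map_poly to b)).
      by rewrite coprimep_map.
    by move=> /coprimep_root /(_ rooty); rewrite rootb eqxx.
  have := curve_irreducible.2 _ ncop (dvdp_gcdl _ _) => /eqp_size eqsz.
  have := dvdp_leq _ (dvdp_gcdr (map_poly to h) (map_poly to b)).
  by rewrite -!size_poly_eq0 eqsz !szF size_poly_eq0 szh => /(_ nzb); rewrite leqNgt ltnS szb.
have := memvf z; rewrite -fully => /Fadjoin1_polyP[p ->].
have [r [a [nzr _ eqa]]] := clear_denominators p.
exists a, r; split=> //; rewrite evE -eqa evC map_polyZ hornerZ mulrC mulKf //.
by rewrite fmorph_eq0 tofrac_eq0.
Qed.
End CurveField.

(** * Local rings presented by residues *)

(** A common description of the local rings at infinity and at the affine points: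
    [F] is the fraction field of the image of [R], [wle m] is a filtration of [R] and
    [lf m] a leading coefficient on its [m]-th step, multiplicative and well defined on
    the image.  The local ring consists of the fractions whose denominator has a
    nonzero leading coefficient in a step that contains the numerator.  At an affine
    point the filtration is trivial and [lf m] is evaluation at the point. *)
Record residue_system (R : comNzRingType) (F L : fieldType)
    (ev : {rmorphism R -> F}) (wle : nat -> R -> Prop) (lf : nat -> R -> L) :
    Prop := ResidueSystem {
  rs_leB : forall m a b, wle m a -> wle m b -> wle m (a - b);
  rs_leM : forall m l a b, wle m a -> wle l b -> wle (m + l)%N (a * b);
  rs_le1 : wle 0%N 1;
  rs_B : forall m a b, lf m (a - b) = lf m a - lf m b;
  rs_M : forall m l a b, wle m a -> wle l b ->
    lf (m + l)%N (a * b) = lf m a * lf l b;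
  rs_1 : lf 0%N 1 = 1;
  rs_ev0 : forall m a, wle m a -> ev a = 0 -> lf m a = 0
}.

Section ResidueSystem.
Variables (R : comNzRingType) (F L : fieldType) (ev : {rmorphism R -> F}).
Variables (wle : nat -> R -> Prop) (lf : nat -> R -> L).

Definition rs_ring (z : F) : Prop := exists m a b,
  [/\ wle m a, wle m b, lf m b != 0 & z = ev a / ev b].
Definition rs_ideal (z : F) : Prop := exists m a b,
  [/\ wle m a, wle m b, lf m b != 0 & z = ev a / ev b /\ lf m a = 0].
Definition rs_unit (z : F) : Prop := exists m a b,
  [/\ wle m a, wle m b, lf m b != 0 & z = ev a / ev b /\ lf m a != 0].

Hypothesis rs : residue_system ev wle lf.

Lemma rs_ev_neq0 m a : wle m a -> lf m a != 0 -> ev a != 0.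
Proof. by move=> la; apply: contraNneq => /(rs_ev0 rs la) ->. Qed.

Lemma rs_ring_case z : rs_ring z -> rs_ideal z \/ rs_unit z.
Proof.
move=> [m [a [b [la lb nzb zE]]]]; have [a0|nza] := eqVneq (lf m a) 0.
  by left; exists m, a, b.
by right; exists m, a, b.
Qed.

Lemma rs_ideal_ring z : rs_ideal z -> rs_ring z.
Proof. by move=> [m [a [b [la lb nzb [zE _]]]]]; exists m, a, b. Qed.

Lemma rs_unit_ring z : rs_unit z -> rs_ring z.
Proof. by move=> [m [a [b [la lb nzb [zE _]]]]]; exists m, a, b. Qed.

Lemma rs_unit_neq0 z : rs_unit z -> z != 0.
Proof.
move=> [m [a [b [la lb nzb [-> nza]]]]].
by rewrite mulf_neq0 ?invr_eq0 ?(rs_ev_neq0 lb) ?(rs_ev_neq0 la).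
Qed.

Lemma rs_unitV z : rs_unit z -> rs_unit z^-1.
Proof.
by move=> [m [a [b [la lb nzb [-> nza]]]]]; exists m, b, a; rewrite invf_div.
Qed.

Lemma rs_unitM z w : rs_unit z -> rs_unit w -> rs_unit (z * w).
Proof.
move=> [m [a [b [la lb nzb [-> nza]]]]] [l [c [d [lc ld nzd [-> nzc]]]]].
exists (m + l)%N, (a * c), (b * d); split; try exact: (rs_leM rs).
  by rewrite (rs_M rs) // mulf_neq0.
by rewrite (rs_M rs) // mulf_neq0 // !rmorphM invfM mulrACA.
Qed.

Lemma rs_ringB z w : rs_ring z -> rs_ring w -> rs_ring (z - w).
Proof.
move=> [m [a [b [la lb nzb ->]]]] [l [c [d [lc ld nzd ->]]]].
exists (m + l)%N, (a * d - c * b), (b * d).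
have lcb : wle (m + l)%N (c * b) by rewrite addnC; apply: (rs_leM rs).
split; try by [apply: (rs_leM rs)|apply: (rs_leB rs) => //; apply: (rs_leM rs)].
  by rewrite (rs_M rs) // mulf_neq0.
have evb := rs_ev_neq0 lb nzb; have evd := rs_ev_neq0 ld nzd.
by rewrite rmorphB !rmorphM /= -!mulNr addf_div.
Qed.

Lemma rs_ringM z w : rs_ring z -> rs_ring w -> rs_ring (z * w).
Proof.
move=> [m [a [b [la lb nzb ->]]]] [l [c [d [lc ld nzd ->]]]].
exists (m + l)%N, (a * c), (b * d); split; try exact: (rs_leM rs).
  by rewrite (rs_M rs) // mulf_neq0.
by rewrite !rmorphM invfM mulrACA.
Qed.

Lemma rs_idealM z w : rs_ideal z -> rs_ring w -> rs_ideal (z * w).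
Proof.
move=> [m [a [b [la lb nzb [-> a0]]]]] [l [c [d [lc ld nzd ->]]]].
exists (m + l)%N, (a * c), (b * d); split; try exact: (rs_leM rs).
  by rewrite (rs_M rs) // mulf_neq0.
by rewrite (rs_M rs) // a0 mul0r !rmorphM invfM mulrACA.
Qed.

Lemma rs_ring1 : rs_ring 1.
Proof.
exists 0%N, 1, 1; rewrite (rs_1 rs) oner_neq0 rmorph1 divr1.
by split=> //; apply: (rs_le1 rs).
Qed.

Lemma rs_ideal1 : ~ rs_ideal 1.
Proof.
move=> [m [a [b [la lb nzb [eq1 a0]]]]].
have evb := rs_ev_neq0 lb nzb.
have : lf m (a - b) = 0.
  apply: (rs_ev0 rs); first exact: (rs_leB rs).
  by rewrite rmorphB -(divfK evb (ev a)) -eq1 mul1r subrr.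
by rewrite (rs_B rs) a0 sub0r => /eqP; rewrite oppr_eq0 (negPf nzb).
Qed.

Lemma rs_idealV z : rs_ideal z -> z != 0 -> ~ rs_ring z^-1.
Proof.
by move=> Iz nz /(rs_idealM Iz); rewrite mulfV //; apply: rs_ideal1.
Qed.

Lemma rs_unitXz z k : rs_unit z -> rs_unit (z ^ k).
Proof.
move=> Uz; have U1 : rs_unit 1.
  exists 0%N, 1, 1; rewrite (rs_1 rs) oner_neq0 rmorph1 divr1.
  by split=> //; apply: (rs_le1 rs).
have UX j : rs_unit (z ^+ j).
  by elim: j => [|j IH]; rewrite ?expr0 // exprS; apply: rs_unitM.
case: k => j; first exact: UX.
by rewrite NegzE -exprnN; apply: rs_unitV; apply: UX.
Qed.

(** Once every nonzero element of [F] is a power of [t] times a unit, the local ring is a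
    discrete valuation ring. *)
Section Uniformizer.
Variable t : F.
Hypotheses (t_ideal : rs_ideal t) (t_neq0 : t != 0).
Hypothesis t_exp : forall z, z != 0 -> exists k u, rs_unit u /\ z = t ^ k * u.

Lemma rs_idealX k : rs_ideal (t ^+ k.+1).
Proof.
elim: k => [|k IH]; first by rewrite expr1.
by rewrite exprS; apply: rs_idealM => //; apply: rs_ideal_ring.
Qed.

Lemma rs_ring_total z : rs_ring z \/ rs_ring z^-1.
Proof.
have [->|nz] := eqVneq z 0.
  left; rewrite -(subrr 1); exact: rs_ringB rs_ring1 rs_ring1.
have RX j : rs_ring (t ^+ j).
  by case: j => [|j]; [rewrite expr0; apply: rs_ring1|apply/rs_ideal_ring/rs_idealX].
have [k [u [Uu ->]]] := t_exp nz; case: k => j.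
  by left; apply: rs_ringM (RX j) (rs_unit_ring Uu).
right; rewrite NegzE invfM -exprnN invrK.
by apply: rs_ringM (RX j.+1) (rs_unit_ring (rs_unitV Uu)).
Qed.

Lemma rs_unit_exp k : rs_unit (t ^ k) -> k = 0.
Proof.
case: k => [[|j]|j] //= Uk.
  have nz := rs_unit_neq0 Uk.
  by case: (rs_idealV (rs_idealX j) nz); apply: rs_unit_ring (rs_unitV Uk).
have := rs_unitV Uk; rewrite NegzE -exprnN invrK => Uj.
case: (rs_idealV (rs_idealX j) (rs_unit_neq0 Uj)).
by rewrite exprnN -NegzE; apply: rs_unit_ring.
Qed.
End Uniformizer.
End ResidueSystem.

Section ConstantResidues.
Variables (K F L : fieldType) (R : comNzRingType) (ev : {rmorphism R -> F}).
Variables (wle : nat -> R -> Prop) (lf : nat -> R -> L).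
Variables (cst : {rmorphism K -> R}) (iota : K -> L).
Hypotheses (rs : residue_system ev wle lf).
Hypotheses (cst_le : forall c, wle 0%N (cst c)) (cst_lf : forall c, lf 0%N (cst c) = iota c).

Lemma rs_ring_const c : rs_ring ev wle lf (ev (cst c)).
Proof.
exists 0%N, (cst c), 1; rewrite (rs_1 rs) oner_neq0 rmorph1 divr1.
by split=> //; apply: (rs_le1 rs).
Qed.

(** If [z^-1] is in the ring, an equation of degree [d] for [z] over [K] expresses [z] as a
    polynomial in [z^-1], after division by [z ^ (d - 1)]. *)
Lemma rs_algebraic_ring (z : F) :
  (rs_ring ev wle lf z \/ rs_ring ev wle lf z^-1) ->
  algebraicOver (ev \o cst) z -> rs_ring ev wle lf z.
Proof.
case=> // RzV [p nzp rootz].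
have R0 : rs_ring ev wle lf 0 by have := rs_ringB rs (rs_ring1 rs) (rs_ring1 rs); rewrite subrr.
have RD u v : rs_ring ev wle lf u -> rs_ring ev wle lf v -> rs_ring ev wle lf (u + v).
  move=> Ru Rv; rewrite -[v]opprK -[- v]sub0r.
  by apply: (rs_ringB rs Ru); apply: (rs_ringB rs R0).
have RX j : rs_ring ev wle lf (z^-1 ^+ j).
  elim: j => [|j IH]; first by rewrite expr0; apply: rs_ring1 rs.
  by rewrite exprS; apply: rs_ringM.
have [->|nzz] := eqVneq z 0; first exact: R0.
have lcp : lead_coef p != 0 by rewrite lead_coef_eq0.
case: (posnP (size p).-1) => [sz1|d_gt0].
  have pC : p = (lead_coef p)%:P.
    by rewrite lead_coefE sz1 -size1_polyC // -[size p]prednK ?size_poly_gt0 // sz1.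
  by move: rootz; rewrite pC map_polyC rootC fmorph_eq0 (negPf lcp).
set d := (size p).-1 in d_gt0; have szp : size p = d.+1 by rewrite prednK ?size_poly_gt0.
have zE : z = - ev (cst (lead_coef p)^-1) *
    \sum_(i < d) ev (cst p`_i) * (z^-1) ^+ (d.-1 - i).
  move: rootz; rewrite /root horner_coef size_map_poly szp big_ord_recr /=.
  rewrite !coef_map /= addr_eq0 => /eqP sumE.
  have lcE : p`_d = lead_coef p by rewrite lead_coefE.
  transitivity (ev (cst (lead_coef p)^-1) * (ev (cst p`_d) * z ^+ d) * z^-1 ^+ d.-1).
    rewrite mulrA -rmorphM /= -rmorphM lcE mulVf // !rmorph1 mul1r.
    by rewrite -{1}(prednK d_gt0) exprS -mulrA exprVn mulfV ?mulr1 // expf_neq0.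
  rewrite -[ev _ * z ^+ d]opprK -sumE mulrN mulNr -mulrA mulr_suml mulNr.
  congr (- (_ * _)); apply: eq_bigr => i _; rewrite coef_map /= -mulrA; congr (_ * _).
  have le_id : (i <= d.-1)%N by rewrite -ltnS prednK.
  by rewrite -{1}(subnK le_id) exprD mulrCA -exprMn mulfV // expr1n mulr1.
rewrite zE -rmorphN /= -rmorphN; apply: rs_ringM rs _ _ (rs_ring_const _) _.
elim/big_ind: _ => // i _; apply: rs_ringM => //; exact: rs_ring_const.
Qed.

Lemma rs_residue z : (forall l, exists c, iota c = l) -> rs_ring ev wle lf z ->
  exists c, rs_ideal ev wle lf (z - ev (cst c)).
Proof.
move=> surj [m [a [b [la lb nzb ->]]]].
have [c cE] := surj (lf m a / lf m b); exists c.
have lcb : wle m (cst c * b) by rewrite -[m]add0n; apply: (rs_leM rs).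
exists m, (a - cst c * b), b; split=> //; first exact: (rs_leB rs).
have evb := rs_ev_neq0 rs lb nzb.
split; first by rewrite rmorphB rmorphM mulrBl mulfK.
rewrite (rs_B rs) -[m in lf m (_ * _)]add0n (rs_M rs) // cst_lf cE.
by rewrite divfK // subrr.
Qed.

(** If the residue field is [K], an algebraic [z] differs from its residue by an algebraic
    element of the maximal ideal; the inverse of such an element, if it existed, would
    be algebraic and hence in the ring. *)
Lemma rs_full_constants z : (forall l, exists c, iota c = l) ->
  (forall w, rs_ring ev wle lf w \/ rs_ring ev wle lf w^-1) ->
  algebraicOver (ev \o cst) z -> exists c, z = ev (cst c).
Proof.
move=> surj total algz.
have [c Izc] := rs_residue surj (rs_algebraic_ring (total z) algz).
exists c; apply/eqP; rewrite -subr_eq0; apply: contraT => nz.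
have algzc : algebraicOver (ev \o cst) (z - ev (cst c)).
  by apply: algebraic_sub => //; apply: algebraic_id.
case: (rs_idealV rs Izc nz); apply: rs_algebraic_ring; first exact: total.
exact: algebraic_inv.
Qed.
End ConstantResidues.

(** * Places of a function field *)

Section AnyPlace.
Variables (K : finFieldType) (F : functionField K) (P : place F).

Lemma place_ringB z w :
  z \in place_ring P -> w \in place_ring P -> z - w \in place_ring P.
Proof. by have [_ BP _] := place_ring_subring P; apply: BP. Qed.

Lemma place_ringM z w :
  z \in place_ring P -> w \in place_ring P -> z * w \in place_ring P.
Proof. by have [_ _ MP] := place_ring_subring P; apply: MP. Qed.

Lemma place_ring1 : 1 \in place_ring P.
Proof. by have [] := place_ring_subring P. Qed.

Lemma place_ring0 : 0 \in place_ring P.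
Proof. by rewrite -(subrr 1); apply: place_ringB; apply: place_ring1. Qed.

Lemma place_ringD z w :
  z \in place_ring P -> w \in place_ring P -> z + w \in place_ring P.
Proof.
move=> Oz Ow; rewrite -[w]opprK; apply: place_ringB => //.
by rewrite -sub0r; apply: place_ringB => //; apply: place_ring0.
Qed.

Lemma place_ringX z k : z \in place_ring P -> z ^+ k \in place_ring P.
Proof.
move=> Oz; elim: k => [|k IH]; first by rewrite expr0 place_ring1.
by rewrite exprS place_ringM.
Qed.

Lemma place_ring_sum (I : Type) (r : seq I) (p : pred I) (f : I -> F) :
  (forall i, p i -> f i \in place_ring P) -> \sum_(i <- r | p i) f i \in place_ring P.
Proof.
by move=> Of; elim/big_ind: _ => //; [apply: place_ring0 | apply: place_ringD].
Qed.

Lemma place_ring_root z k : (0 < k)%N -> z ^+ k \in place_ring P -> z \in place_ring P.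
Proof.
case: k => // k _ Ozk; have [//|OzV] := place_ring_val P z.
have [->|nz] := eqVneq z 0; first exact: place_ring0.
rewrite -[z](mulfK (expf_neq0 k nz)) -exprS -exprVn.
by rewrite place_ringM // place_ringX.
Qed.

Lemma place_ideal_ring z : z \in place_ideal P -> z \in place_ring P.
Proof. by case/andP. Qed.

Lemma place_idealM z w :
  z \in place_ideal P -> w \in place_ring P -> z * w \in place_ideal P.
Proof.
move=> /andP[Oz Uz] Ow; apply/andP; split; first exact: place_ringM.
apply: contra Uz => /and3P[_ nzw Ozw]; move: nzw; rewrite mulf_eq0 negb_or.
case/andP=> nz nw; apply/and3P; split=> //.
have -> : z^-1 = (z * w)^-1 * w by rewrite invfM -mulrA mulVf // mulr1.
exact: place_ringM.
Qed.

Lemma place_ideal1 : 1 \notin place_ideal P.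
Proof. by rewrite /= !inE place_ring1 invr1 oner_neq0 place_ring1. Qed.

Lemma place_ideal_unit z w : z \in place_ideal P -> z * w = 1 ->
  w \notin place_ring P.
Proof.
move=> Iz zw; apply: contra place_ideal1 => Ow.
by rewrite -zw place_idealM.
Qed.

Lemma const_notin_ideal c : c != 0 -> ff_const F c \notin place_ideal P.
Proof.
move=> nzc; apply: contra place_ideal1 => /place_idealM /(_ (place_ring_const P c^-1)).
by rewrite -rmorphM mulfV // rmorph1.
Qed.

Lemma place_idealN z : z \in place_ideal P -> - z \in place_ideal P.
Proof.
move=> Iz; rewrite -mulrN1; apply: place_idealM => //.
by rewrite -sub0r place_ringB ?place_ring0 ?place_ring1.
Qed.

(** In a valuation ring one of two elements divides the other. *)
Lemma place_idealB z w :
  z \in place_ideal P -> w \in place_ideal P -> z - w \in place_ideal P.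
Proof.
move=> Iz Iw.
wlog [u Ou wE] : z w Iz Iw / exists2 u, u \in place_ring P & w = z * u.
  move=> IH; have [z0|nz] := eqVneq z 0; first by rewrite z0 sub0r place_idealN.
  have [w0|nw] := eqVneq w 0; first by rewrite w0 subr0.
  have [Owz|Ozw] := place_ring_val P (w / z).
    by apply: IH => //; exists (w / z) => //; rewrite mulrCA mulfV ?mulr1.
  rewrite -opprB; apply: place_idealN.
  apply: IH => //; exists (z / w); first by rewrite -invf_div.
  by rewrite mulrCA mulfV ?mulr1.
by rewrite wE -{1}[z]mulr1 -mulrBr place_idealM // place_ringB ?place_ring1.
Qed.

Lemma residue_uniq z c d : z - ff_const F c \in place_ideal P ->
  z - ff_const F d \in place_ideal P -> c = d.
Proof.
move=> Ic Id; apply/eqP; rewrite -subr_eq0; apply: contraT => /const_notin_ideal.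
have -> : ff_const F (c - d) = (z - ff_const F d) - (z - ff_const F c).
  by rewrite rmorphB opprB [RHS]addrC addrA subrK.
by rewrite place_idealB.
Qed.

Lemma place_evalE z c : z - ff_const F c \in place_ideal P -> place_eval P z = c.
Proof.
move=> Ic; rewrite /place_eval; case: pickP => [d /residue_uniq /(_ Ic)|/(_ c)] //.
by rewrite Ic.
Qed.

Lemma rational_placeP :
  (forall z, z \in place_ring P -> exists c, z - ff_const F c \in place_ideal P) ->
  rational_place P.
Proof.
move=> res; exists (fun _ => 1); split=> [_|z Oz]; first exact: place_ring1.
have [c Ic] := res z Oz; exists [ffun=> c]; split=> [|d].
  by rewrite big_ord1 ffunE mulr1.
rewrite big_ord1 mulr1 => Id; apply/ffunP => i.
by rewrite ffunE (ord1 i) (residue_uniq Ic Id).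
Qed.

(** The case distinction is needed because [valuation] has a default value; the default
    is zero, so the bound holds for it too. *)
Lemma valuation_ge0 z : z \in place_ring P -> z != 0 -> 0 <= valuation P z.
Proof.
move=> Oz nz; rewrite /valuation; case: xgetP => [m _ [t [u [prt Uu zE]]]|//].
have It : t \in place_ideal P by apply/prt; exists 1; rewrite ?place_ring1 ?mulr1.
case: m zE => // k; rewrite NegzE -exprnN => zE.
have nzt : t != 0.
  by apply: contraNneq nz => t0; rewrite zE t0 exprS mul0r invr0 mul0r.
have [_ nzu OuV] := and3P Uu.
have /(place_ideal_unit It)/negP[] : t * (t ^+ k * (z * u^-1)) = 1.
  by rewrite mulrA -exprS zE mulfK ?mulfV ?expf_neq0.
by rewrite !place_ringM ?place_ringX // place_ideal_ring.
Qed.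
End AnyPlace.

Lemma place_ext (K : finFieldType) (F : functionField K) (P P' : place F) :
  place_ring P =i place_ring P' -> P = P'.
Proof.
case: P P' => [O a b c d e] [O' a' b' c' d' e'] /= eqO.
have OO' : O = O' by apply/funext => z; apply: eqO.
subst O'; congr Place; apply: Prop_irrelevance.
Qed.

(** A discrete valuation ring is maximal among the proper subrings of its field. *)
Lemma place_sub_eq (K : finFieldType) (F : functionField K) (P P' : place F) t :
  (forall z, z != 0 -> exists k u, u \in place_unit P /\ z = t ^ k * u) ->
  {subset place_ring P <= place_ring P'} -> t \in place_ideal P -> P = P'.
Proof.
move=> t_exp sPP' It; apply: place_ext => z; apply/idP/idP; first exact: sPP'.
move=> Oz; apply: contraT => nOz.
have nz : z != 0 by apply: contraNneq nOz => ->; apply: place_ring0.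
have [y nOy] := place_ring_proper P'.
(* An element of the larger ring outside of the smaller one has a negative power of
   [t] in it, whence [t^-1] itself. *)
have OtV : t^-1 \in place_ring P'.
  have [k [u [/and3P[Ou nu OuV] zE]]] := t_exp z nz; case: k zE => k zE.
    by case/negP: nOz; rewrite zE place_ringM // place_ringX // place_ideal_ring.
  apply: (place_ring_root (ltn0Sn k)); rewrite exprVn.
  rewrite NegzE -exprnN in zE.
  have -> : (t ^+ k.+1)^-1 = z * u^-1 by rewrite zE mulfK.
  by rewrite place_ringM // sPP'.
case/negP: nOy; have [->|ny] := eqVneq y 0; first exact: place_ring0.
have [k [u [/and3P[Ou nu OuV] ->]]] := t_exp y ny; apply: place_ringM; last exact: sPP'.
case: k => k; first by rewrite place_ringX // sPP' // place_ideal_ring.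
by rewrite NegzE -exprnN -exprVn place_ringX.
Qed.

Section ResiduePlace.
Variables (K : finFieldType) (F : functionField K) (L : fieldType).
Variables (R : comNzRingType) (ev : {rmorphism R -> F}).
Variables (wle : nat -> R -> Prop) (lf : nat -> R -> L).
Variables (cst : {rmorphism K -> R}).
Hypotheses (rs : residue_system ev wle lf).
Hypotheses (cst_le : forall c, wle 0%N (cst c)).
Hypothesis (ev_cst : forall c, ev (cst c) = ff_const F c).
Variable t : F.
Hypotheses (t_ideal : rs_ideal ev wle lf t) (t_neq0 : t != 0).
Hypothesis t_exp : forall z, z != 0 ->
  exists k u, rs_unit ev wle lf u /\ z = t ^ k * u.

Let Oring : {pred F} := [pred z | `[< rs_ring ev wle lf z >]].

Let OP z : reflect (rs_ring ev wle lf z) (z \in Oring).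
Proof. exact: asboolP. Qed.

Fact residue_place_subring : subring_closed Oring.
Proof.
split=> [|z w /OP Oz /OP Ow|z w /OP Oz /OP Ow]; apply/OP.
- exact: (rs_ring1 rs).
- exact: (rs_ringB rs Oz Ow).
- exact: (rs_ringM rs Oz Ow).
Qed.

Fact residue_place_const c : ff_const F c \in Oring.
Proof. by apply/OP; rewrite -ev_cst; apply: rs_ring_const. Qed.

Fact residue_place_neq_const : exists2 z : F, z \in Oring & forall c : K, z != ff_const F c.
Proof.
exists t => [|c]; first exact/OP/rs_ideal_ring.
apply: contra_notN (rs_idealV rs t_ideal t_neq0) => /eqP ->.
by rewrite -fmorphV -ev_cst; apply: rs_ring_const.
Qed.

Fact residue_place_proper : exists z : F, z \notin Oring.
Proof. by exists t^-1; apply/OP/(rs_idealV rs t_ideal t_neq0). Qed.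

Fact residue_place_val (z : F) : z \in Oring \/ z^-1 \in Oring.
Proof.
by have [Oz|Oz] := rs_ring_total rs t_ideal t_exp z; [left|right]; apply/OP.
Qed.

Definition residue_place : place F :=
  Place residue_place_subring residue_place_const residue_place_neq_const
        residue_place_proper residue_place_val.

Lemma residue_place_ringP z :
  reflect (rs_ring ev wle lf z) (z \in place_ring residue_place).
Proof. exact: OP. Qed.

Lemma residue_place_unitP z :
  reflect (rs_unit ev wle lf z) (z \in place_unit residue_place).
Proof.
apply: (iffP and3P) => [[/OP Oz nz /OP OzV]|Uz].
  have [Iz|//] := rs_ring_case Oz.
  by case: (rs_idealV rs Iz nz).
split; last by apply/OP/rs_unit_ring/rs_unitV.
  exact/OP/rs_unit_ring.
exact: (rs_unit_neq0 rs Uz).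
Qed.

Lemma residue_place_idealP z :
  reflect (rs_ideal ev wle lf z) (z \in place_ideal residue_place).
Proof.
apply: (iffP andP) => [[/OP Oz /residue_place_unitP Uz]|Iz].
  by have [] := rs_ring_case Oz.
split; first exact/OP/rs_ideal_ring.
apply/residue_place_unitP => Uz.
apply: (rs_idealV rs Iz (rs_unit_neq0 rs Uz)).
exact/rs_unit_ring/rs_unitV.
Qed.

Lemma residue_place_prime : prime_element residue_place t.
Proof.
move=> z; split=> [/residue_place_idealP Iz|[y /OP Oy ->]]; last first.
  by apply/residue_place_idealP/rs_idealM.
exists (t^-1 * z); last by rewrite mulVKf.
apply/OP; have [->|nz] := eqVneq z 0.
  by rewrite mulr0; apply/OP; apply: (place_ring0 residue_place).
have [k [u [Uu zE]]] := t_exp nz; rewrite zE in Iz *.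
have RX j : rs_ring ev wle lf (t ^+ j).
  by apply/OP; apply: (@place_ringX _ _ residue_place); apply/OP/rs_ideal_ring.
case: k {zE nz} Iz => [[|j]|j] Iz.
- rewrite expr0z mul1r in Iz.
  by case: (rs_idealV rs Iz (rs_unit_neq0 rs Uu)); apply/rs_unit_ring/rs_unitV.
- rewrite mulrA -exprnP exprS mulKf //; apply: (rs_ringM rs (RX j)).
  exact: rs_unit_ring.
- have nzt : t ^ Negz j * u != 0 by rewrite mulf_neq0 ?expfz_neq0 // (rs_unit_neq0 rs Uu).
  case: (rs_idealV rs Iz nzt); rewrite invfM NegzE -exprnN invrK.
  by apply: (rs_ringM rs (RX _)); apply/rs_unit_ring/rs_unitV.
Qed.

(** Any other prime element differs from [t] by a unit, and no nonzero power of [t] is a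
    unit; hence the exponent does not depend on the choice made by [valuation]. *)
Lemma residue_place_valuation k u : rs_unit ev wle lf u ->
  valuation residue_place (t ^ k * u) = k.
Proof.
move=> Uu; rewrite /valuation; case: xgetP => [m _ [t' [u' [prt' Uu' zE]]]|]; last first.
  by move=> /(_ k) []; exists t, u; split=> //;
    [apply: residue_place_prime|apply/residue_place_unitP].
have /residue_place_prime[w Ow t'E] : t' \in place_ideal residue_place.
  by apply/prt'; exists 1; rewrite ?place_ring1 ?mulr1.
have /prt'[w' Ow' tE] : t \in place_ideal residue_place by apply/residue_place_idealP.
have ww' : w * w' = 1.
  by apply: (mulfI t_neq0); rewrite mulrA -t'E -tE mulr1.
have nw : w != 0 by apply/eqP => w0; move/eqP: ww'; rewrite w0 mul0r eq_sym oner_eq0.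
have Uw : rs_unit ev wle lf w.
  apply/residue_place_unitP/and3P; split=> //.
  by rewrite -[w^-1]mulr1 -ww' mulKf.
have Uv : rs_unit ev wle lf (w ^ m * u').
  by apply: (rs_unitM rs (rs_unitXz rs _ Uw)); apply/residue_place_unitP.
have : rs_unit ev wle lf (t ^ (m - k)).
  have -> : t ^ (m - k) = u / (w ^ m * u').
    have uE : u = t ^ (m - k) * (w ^ m * u').
      apply: (mulfI (expfz_neq0 k t_neq0)).
      by rewrite zE t'E expfzMl [RHS]mulrA -(expfzDr k) // addrC subrK mulrA.
    by rewrite {1}uE mulfK // (rs_unit_neq0 rs Uv).
  exact: (rs_unitM rs Uu (rs_unitV Uv)).
by move/(rs_unit_exp rs t_ideal)/eqP; rewrite subr_eq0 => /eqP.
Qed.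
End ResiduePlace.

(** * The place at infinity *)

Lemma exprz_subn (F : fieldType) (k l : nat) (t : F) : t != 0 ->
  t ^ (k%:Z - l%:Z) = t ^+ k * (t ^+ l)^-1.
Proof. by move=> nzt; rewrite expfzDr // exprnN. Qed.

Section CurveModel.
Variables (K : fieldType) (q n : nat).
Hypotheses (q_gt1 : (1 < q)%N) (n_gt1 : (1 < n)%N).

Local Notation R := {poly {poly K}}.
Local Notation Q := (q ^ n.-1)%N.
Local Notation M := (trace_exp q n).
Local Notation h := (curve_poly K q n).

Variables (F : fieldType) (g : {rmorphism K -> F}) (x y : F).
Local Notation ev := (eval2 g x y).
Local Notation inf_system :=
  (@residue_system R F K (ev : {rmorphism R -> F}) (@weight_le K q n) (@lead_form K q n)).
Local Notation inf_ideal :=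
  (@rs_ideal R F K (ev : {rmorphism R -> F}) (@weight_le K q n) (@lead_form K q n)).
Local Notation inf_unit :=
  (@rs_unit R F K (ev : {rmorphism R -> F}) (@weight_le K q n) (@lead_form K q n)).
Hypothesis ev_ker : forall a, ev a = 0 -> exists c, a = c * h.

Lemma weight_residue_system : inf_system.
Proof.
split.
- exact: weight_leB.
- by move=> m l a b; apply: weight_leM.
- by have := weight_le_const q n (1 : K); rewrite !polyC1.
- exact: lead_formB.
- by move=> m l a b; apply: lead_formM.
- by have := lead_form_const q n (1 : K); rewrite !polyC1.
- by move=> m a la /ev_ker[c]; apply: (lead_form_curve q_gt1 n_gt1 la).
Qed.

Hypothesis ev_curve : ev h = 0.
Hypothesis ev_frac :
  forall z, exists (a : R) (r : {poly K}), r != 0 /\ z = ev a / ev r%:P.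

Lemma ev_reduced_eq0 (a : R) : (size a <= Q)%N -> ev a = 0 -> a = 0.
Proof.
move=> sza /ev_ker[c aE]; apply/eqP; apply: contraT => nza.
have [m [la nzl]] := reduced_lead_form q_gt1 n_gt1 sza nza.
by move: nzl; rewrite (lead_form_curve q_gt1 n_gt1 la aE) eqxx.
Qed.

Lemma ev_polyC_neq0 (r : {poly K}) : r != 0 -> ev r%:P != 0.
Proof.
apply: contraNneq => /ev_reduced_eq0 r0; rewrite -polyC_eq0; apply/eqP/r0.
by rewrite (leq_trans (size_polyC_leq1 _)) // ltnW // expQ_gt1.
Qed.

Lemma ev_reduce a : exists2 b : R, (size b <= Q)%N & ev a = ev b.
Proof.
have [b szb [c ->]] := curve_reduce q_gt1 n_gt1 a; exists b => //.
by rewrite rmorphD rmorphM /= ev_curve mulr0 add0r.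
Qed.

Lemma ev_frac_reduced z :
  exists (a : R) (r : {poly K}), [/\ (size a <= Q)%N, r != 0 & z = ev a / ev r%:P].
Proof.
have [a [r [nzr ->]]] := ev_frac z; have [b szb ->] := ev_reduce a.
by exists b, r.
Qed.

Lemma ev_lead_form a : ev a != 0 ->
  exists m (b : R), [/\ (size b <= Q)%N, ev a = ev b, weight_le q n m b & lead_form q n m b != 0].
Proof.
move=> nza; have [b szb eab] := ev_reduce a.
have nzb : b != 0 by apply: contraNneq nza; rewrite eab => ->; rewrite rmorph0.
by have [m [lb nzl]] := reduced_lead_form q_gt1 n_gt1 szb nzb; exists m, b.
Qed.

(** Since [Q] and [M] are coprime, [u * Q = v * M + 1] has a solution, and
    [t = y ^ v / x ^ u] has weight [-1]. *)
Lemma infinity_uniformizer : exists t : F,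
  [/\ inf_ideal t, t != 0
    & forall m a, weight_le q n m a -> lead_form q n m a != 0 ->
        inf_unit (t ^+ m * ev a)].
Proof.
have rs := weight_residue_system.
have Q_gt0 : (0 < Q)%N by rewrite ltnW // expQ_gt1.
case: (egcdnP M Q_gt0) => u v; rewrite (eqP (coprime_weights q n_gt1)) => uvE _.
have monE i j : ev (('X^i)%:P * 'X^j) = x ^+ i * y ^+ j.
  by rewrite rmorphM polyC_exp !rmorphXn /= eval2CX eval2X.
have [lx lfx] := weight_monomial K q n u 0; have [ly lfy] := weight_monomial K q n 0 v.
rewrite mul0n addn0 in lx lfx; rewrite mul0n add0n in ly lfy.
have nzx : ev (('X^u)%:P * 'X^0) != 0 by rewrite (rs_ev_neq0 rs lx) ?lfx ?oner_neq0.
have nzy : ev (('X^0)%:P * 'X^v) != 0 by rewrite (rs_ev_neq0 rs ly) ?lfy ?oner_neq0.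
exists (ev (('X^0)%:P * 'X^v) / ev (('X^u)%:P * 'X^0)); split.
- exists (u * Q)%N, (('X^0)%:P * 'X^v), (('X^u)%:P * 'X^0); rewrite lfx oner_neq0.
  have lt_vu : (v * M < u * Q)%N by rewrite uvE addn1.
  split=> //; first exact: weight_le_trans (ltnW lt_vu) ly.
  by split=> //; apply: lead_form_small lt_vu ly.
- by rewrite mulf_neq0 ?invr_eq0.
move=> m a la nzl.
have [lx' lfx'] := weight_monomial K q n (u * m) 0.
have [ly' lfy'] := weight_monomial K q n 0 (v * m).
have umE : (u * m * Q + 0 * M = 0 * Q + v * m * M + m)%N.
  by rewrite !mul0n addn0 add0n mulnAC uvE mulnDl mul1n mulnAC.
exists (0 * Q + v * m * M + m)%N, (('X^0)%:P * 'X^(v * m) * a), (('X^(u * m))%:P * 'X^0).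
split.
- exact: weight_leM.
- by rewrite -umE.
- by rewrite -umE lfx' oner_neq0.
rewrite lead_formM // lfy' mul1r; split=> //.
suff E : (ev (('X^0)%:P * 'X^v) / ev (('X^u)%:P * 'X^0)) ^+ m * ev a =
    ev (('X^0)%:P * 'X^(v * m)) * ev a / ev (('X^(u * m))%:P * 'X^0).
  by apply: (etrans E); congr (_ / _); apply/esym/rmorphM.
by rewrite !monE !expr0 !mul1r !mulr1 expr_div_n -!exprM mulrAC.
Qed.

Lemma infinity_exp t :
  (forall m a, weight_le q n m a -> lead_form q n m a != 0 ->
     inf_unit (t ^+ m * ev a)) ->
  t != 0 -> forall z, z != 0 -> exists (k : int) u,
    inf_unit u /\ z = t ^ k * u.
Proof.
move=> t_unit nzt z; have [a [r [nzr ->]]] := ev_frac z.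
have rs := weight_residue_system.
rewrite mulf_eq0 invr_eq0 negb_or => /andP[nza nzer].
have [m [b [_ -> lb nzb]]] := ev_lead_form nza.
have [l [c [_ -> lc nzc]]] := ev_lead_form nzer.
exists (l%:Z - m%:Z), ((t ^+ m * ev b) / (t ^+ l * ev c)); split.
  by apply: (rs_unitM rs (t_unit _ _ lb nzb)); apply: rs_unitV; apply: t_unit.
have alg (A B u v : F) : A != 0 -> B != 0 -> u / v = A / B * (B * u / (A * v)).
  move=> nzA nzB; have AB1 : A / B * (B / A) = 1 by rewrite mulrA divfK ?mulfV.
  by rewrite invfM [B * u * _]mulrACA [RHS]mulrA AB1 mul1r.
by rewrite exprz_subn // -alg ?expf_neq0.
Qed.
End CurveModel.

Lemma eval2_wide (K : fieldType) (S : comNzRingType) (g : {rmorphism K -> S})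
    (x y : S) m (a : {poly {poly K}}) : (size a <= m)%N ->
  eval2 g x y a = \sum_(j < m) (map_poly g a`_j).[x] * y ^+ j.
Proof.
move=> le_m; rewrite eval2E (big_ord_widen m (fun j => (map_poly g a`_j).[x] * y ^+ j)) //.
rewrite big_mkcond; apply: eq_bigr => j _; case: ltnP => // le_j.
by rewrite nth_default // rmorph0 horner0 mul0r.
Qed.

(** The coordinate ring of the curve has fraction field [F], with denominators in [K[x]]. *)
Definition curve_model (K : fieldType) (q n : nat) (F : fieldType)
    (g : {rmorphism K -> F}) (x y : F) : Prop :=
  [/\ eval2 g x y (curve_poly K q n) = 0,
      forall a, eval2 g x y a = 0 -> exists c, a = c * curve_poly K q n
    & forall z, exists (a : {poly {poly K}}) (r : {poly K}),
        r != 0 /\ z = eval2 g x y a / eval2 g x y r%:P].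

(** The full constant field is found at infinity, where the residue field is [K]. *)
Lemma norm_trace_function_field (K : finFieldType) (q n : nat) :
  (1 < q)%N -> (1 < n)%N ->
  exists (F : functionField K) (x y : F), curve_model q n (ff_const F) x y.
Proof.
move=> q_gt1 n_gt1.
have [F [x [y [g [ev_curve ev_ker ev_frac]]]]] := curve_field_exists K q_gt1 n_gt1.
have rs := weight_residue_system q_gt1 n_gt1 ev_ker.
have [t [It nzt t_unit]] := infinity_uniformizer q_gt1 n_gt1 ev_ker.
have t_exp := infinity_exp q_gt1 n_gt1 ev_ker ev_curve ev_frac t_unit nzt.
have ax : function_field_axiom g.
  exists x; split=> [[p nzp rootp]|].
    have := ev_polyC_neq0 q_gt1 n_gt1 ev_ker nzp.
    by rewrite eval2C; move/rootP: rootp => ->; rewrite eqxx.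
  exists (q ^ n.-1)%N, (fun i => y ^+ i) => z.
  have [a [r [sza nzr ->]]] := ev_frac_reduced q_gt1 n_gt1 ev_curve ev_frac z.
  exists (fun i => (map_poly g a`_i).[x] / eval2 g x y r%:P); split=> [i|].
    exists a`_i, r; rewrite -!(eval2C g x y); split=> //.
    exact: (ev_polyC_neq0 q_gt1 n_gt1 ev_ker nzr).
  by rewrite (eval2_wide _ _ _ sza) mulr_suml; apply: eq_bigr => i _; rewrite mulrAC.
have full (z : F) : algebraicOver g z -> exists c : K, z = g c.
  move=> [p nzp rootp].
  pose cst : {rmorphism K -> {poly {poly K}}} := polyC \o polyC.
  have algz : algebraicOver ((eval2 g x y : {rmorphism {poly {poly K}} -> F}) \o cst) z.
    exists p => //; rewrite (eq_map_poly (g := g)) // => c /=; exact: eval2CC.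
  have surj (l : K) : exists c : K, id c = l by exists l.
  have [c ->] := @rs_full_constants _ _ _ _ _ _ _ cst id rs
    (weight_le_const q n) (lead_form_const q n) z surj (rs_ring_total rs It t_exp) algz.
  by exists c; rewrite /= eval2CC.
by exists (FunctionField ax full), x, y.
Qed.

Section PlaceWithPole.
Variables (K : finFieldType) (F : functionField K) (P : place F).

Lemma place_idealV z : z \notin place_ring P -> z^-1 \in place_ideal P.
Proof.
move=> nOz; have [Oz|OzV] := place_ring_val P z; first by rewrite Oz in nOz.
by rewrite !inE OzV invrK (negPf nOz) !andbF.
Qed.

Lemma place_ideal_sum (I : Type) (r : seq I) (p : pred I) (f : I -> F) :
  (forall i, p i -> f i \in place_ideal P) -> \sum_(i <- r | p i) f i \in place_ideal P.
Proof.
move=> If; elim/big_ind: _ => //; first by rewrite !inE place_ring0 eqxx.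
by move=> u v Iu Iv; rewrite -[v]opprK place_idealB // place_idealN.
Qed.

Lemma place_idealX z k : (0 < k)%N -> z \in place_ideal P -> z ^+ k \in place_ideal P.
Proof.
by case: k => // k _ Iz; rewrite exprS place_idealM // place_ringX // place_ideal_ring.
Qed.

Lemma place_unit_const c w : c != 0 -> w \in place_ideal P ->
  ff_const F c + w != 0 /\ (ff_const F c + w)^-1 \in place_ring P.
Proof.
move=> nzc Iw; have nI : ff_const F c + w \notin place_ideal P.
  apply: contra (const_notin_ideal P nzc) => Iu.
  by rewrite -[ff_const F c](addrK w) place_idealB.
have Ou : ff_const F c + w \in place_ring P.
  by rewrite place_ringD ?place_ring_const // place_ideal_ring.
by move: nI; rewrite inE Ou /= negbK => /and3P[].
Qed.

Variables (q n : nat) (x y : F).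
Hypotheses (q_gt1 : (1 < q)%N) (n_gt1 : (1 < n)%N).
Local Notation Q := (q ^ n.-1)%N.
Local Notation M := (trace_exp q n).
Hypothesis curve_xy : trace_pow q n y = x ^+ M.

(** If [y] has a pole, [y ^ Q] dominates the other terms of the trace, which are
    [y ^ Q] times elements of the maximal ideal. *)
Lemma pole_y_ratio : y \notin place_ring P ->
  exists2 u, u \in place_ring P & y ^+ Q = u * x ^+ M.
Proof.
move=> nOy; have ny : y != 0 by apply: contraNneq nOy => ->; apply: place_ring0.
have Q_gt0 : (0 < Q)%N by rewrite ltnW // expQ_gt1.
pose w := \sum_(j < n.-1) (y^-1) ^+ (Q - q ^ j).
have Iw : w \in place_ideal P.
  apply: place_ideal_sum => j _; apply: place_idealX (place_idealV nOy).
  by rewrite subn_gt0 ltn_exp2l.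
have TE : trace_pow q n y = y ^+ Q * (ff_const F 1 + w).
  rewrite rmorph1 mulrDr mulr1 mulr_sumr /trace_pow.
  case: n n_gt1 @w Iw => // n' _ w Iw; rewrite big_ord_recr /= addrC; congr (_ + _).
  apply: eq_bigr => j _; have le_j : (q ^ j <= q ^ n')%N by rewrite leq_exp2l // ltnW.
  have -> : y ^+ (q ^ n') = y ^+ (q ^ n' - q ^ j) * y ^+ (q ^ j) by rewrite -exprD subnK.
  by rewrite mulrAC -exprMn mulfV // expr1n mul1r.
have [nzu Ou] := place_unit_const (oner_neq0 K) Iw.
by exists (ff_const F 1 + w)^-1 => //; rewrite -curve_xy TE mulrC mulfK.
Qed.

(** Either of [x] and [y] is integral over the ring generated by the other. *)
Lemma pole_x_iff_y : (x \in place_ring P) = (y \in place_ring P).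
Proof.
have Q_gt0 : (0 < Q)%N by rewrite ltnW // expQ_gt1.
apply/idP/idP => [Ox|Oy]; last first.
  apply: (place_ring_root (trace_exp_gt0 q n_gt1)); rewrite -curve_xy.
  by apply: place_ring_sum => j _; apply: place_ringX.
apply: contraT => nOy; case/negP: (nOy); apply: (place_ring_root Q_gt0).
by have [u Ou ->] := pole_y_ratio nOy; rewrite place_ringM ?place_ringX.
Qed.

Hypothesis pole_x : x \notin place_ring P.

Let nx : x != 0.
Proof. by apply: contraNneq pole_x => ->; apply: place_ring0. Qed.

(** Valuation rings are integrally closed, and by [pole_y_ratio] the [Q]-th power of the
    left-hand side is a nonnegative power of [x^-1] times an element of the ring. *)
Lemma pole_monomial_ring i j d : (i * Q + j * M <= d * Q)%N ->
  x ^+ i * y ^+ j / x ^+ d \in place_ring P.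
Proof.
move=> le_d; have Q_gt0 : (0 < Q)%N by rewrite ltnW // expQ_gt1.
have [u Ou yE] : exists2 u, u \in place_ring P & y ^+ Q = u * x ^+ M.
  by apply: pole_y_ratio; rewrite -pole_x_iff_y.
apply: (place_ring_root Q_gt0).
rewrite expr_div_n exprMn [(y ^+ j) ^+ Q]exprAC yE -!exprM exprMn -exprM mulrCA -exprD.
rewrite [(M * j)%N]mulnC -mulrA; apply: place_ringM; first exact: place_ringX.
have -> : x ^+ (d * Q) = x ^+ (d * Q - (i * Q + j * M)) * x ^+ (i * Q + j * M).
  by rewrite -exprD subnK.
rewrite invfM mulrCA mulfV ?expf_neq0 // mulr1 -exprVn.
by rewrite place_ringX // place_ideal_ring // place_idealV.
Qed.

Lemma pole_inv_poly (r : {poly K}) : r != 0 ->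
  x ^+ (size r).-1 / (map_poly (ff_const F) r).[x] \in place_ring P.
Proof.
move=> nzr; set d := (size r).-1.
have szr : size r = d.+1 by rewrite prednK // size_poly_gt0.
pose w := \sum_(i < d) ff_const F r`_i * x^-1 ^+ (d - i).
have Iw : w \in place_ideal P.
  apply: place_ideal_sum => i _; rewrite mulrC place_idealM ?place_ring_const //.
  by rewrite place_idealX ?subn_gt0 // place_idealV.
have nzc : lead_coef r != 0 by rewrite lead_coef_eq0.
have [nzu Ou] := place_unit_const nzc Iw.
have -> : (map_poly (ff_const F) r).[x] = x ^+ d * (ff_const F (lead_coef r) + w).
  rewrite horner_coef size_map_poly szr big_ord_recr /= addrC mulrDr mulr_sumr.
  rewrite coef_map /= lead_coefE szr /= [x ^+ d * ff_const F _]mulrC; congr (_ + _).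
  apply: eq_bigr => i _; rewrite coef_map /= mulrCA; congr (_ * _).
  have -> : x ^+ d = x ^+ i * x ^+ (d - i) by rewrite -exprD subnKC // ltnW.
  by rewrite -mulrA -exprMn mulfV ?expr1n ?mulr1.
by rewrite invfM mulrA mulfV ?expf_neq0 // mul1r.
Qed.
End PlaceWithPole.

Section InfinityPlace.
Variables (K : finFieldType) (q n : nat) (F : functionField K) (x y : F).
Hypotheses (q_gt1 : (1 < q)%N) (n_gt1 : (1 < n)%N).
Hypothesis model : curve_model q n (ff_const F) x y.

Local Notation R := {poly {poly K}}.
Local Notation Q := (q ^ n.-1)%N.
Local Notation M := (trace_exp q n).
Local Notation h := (curve_poly K q n).
Local Notation ev := (eval2 (ff_const F) x y).

Lemma model_curve : trace_pow q n y = x ^+ M.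
Proof.
have [ev_h _ _] := model; apply/eqP; rewrite -subr_eq0.
by rewrite -(eval2_curve q n (ff_const F) x y) ev_h.
Qed.

Lemma weight_le_polyC (r : {poly K}) : weight_le q n ((size r).-1 * Q) r%:P.
Proof.
apply/(@weight_leP K q n n_gt1 _ _) => i j; rewrite coefC; case: j => [|j] /=;
  last by rewrite coef0 eqxx.
move=> nz; rewrite mul0n addn0 leq_mul2r; apply/orP; right.
by rewrite -ltnS; apply: leq_trans (leqSpred _); rewrite ltnNge;
  apply: contra nz => /leq_sizeP ->.
Qed.

Lemma lead_form_unique_le m l (a : R) :
  weight_le q n m a -> lead_form q n l a != 0 -> (l <= m)%N.
Proof.
move=> la; apply: contraR; rewrite -ltnNge => lt_ml.
by rewrite (lead_form_small lt_ml la) eqxx.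
Qed.

(** Uniqueness of the place where [x] has a pole: the ring of such a place contains, by
    [pole_monomial_ring], all quotients of weight at most zero, that is, the discrete
    valuation ring at infinity; these rings are equal by [place_sub_eq]. *)
Lemma infinity_place_exists : exists P : place F,
  [/\ rational_place P,
      forall P' : place F, P' <> P -> x \in place_ring P'
    & forall m (a : R), (size a <= Q)%N -> a != 0 ->
        (0 <= valuation P (ev a) + m%:Z) <-> weight_le q n m a].
Proof.
have [ev_h ev_ker ev_frac] := model.
have rs := weight_residue_system q_gt1 n_gt1 ev_ker.
have [t [It nzt t_unit]] := infinity_uniformizer q_gt1 n_gt1 ev_ker.
have t_exp := infinity_exp q_gt1 n_gt1 ev_ker ev_h ev_frac t_unit nzt.
pose cst : {rmorphism K -> R} := polyC \o polyC.
have ev_cst c : ev (cst c) = ff_const F c by apply: eval2CC.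
pose P := @residue_place K F K R (ev : {rmorphism R -> F}) (@weight_le K q n)
  (@lead_form K q n) cst rs (weight_le_const q n) ev_cst t It nzt t_exp.
exists P; split.
- apply: rational_placeP => z /residue_place_ringP Oz.
  have surj (l : K) : exists c : K, id c = l by exists l.
  have [c Ic] := @rs_residue _ _ _ _ _ _ _ cst id rs
    (weight_le_const q n) (lead_form_const q n) z surj Oz.
  by exists c; apply/residue_place_idealP; rewrite -ev_cst.
- move=> P' neP; apply: contra_notT neP => nOx; apply/esym.
  apply: (@place_sub_eq _ _ P P' t); last exact/residue_place_idealP.
    move=> z /t_exp[k [u [Uu zE]]]; exists k, u; split=> //.
    exact/residue_place_unitP.
  move=> z /residue_place_ringP[k [a0 [b0 [la0 lb0 nzb0 zE]]]].
  have [a [r [sza nzr zE']]] := ev_frac_reduced q_gt1 n_gt1 ev_h ev_frac z.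
  have [a_0|nza] := eqVneq a 0.
    by rewrite zE' a_0 rmorph0 mul0r place_ring0.
  have nzer := ev_polyC_neq0 q_gt1 n_gt1 ev_ker nzr.
  have nzeb := rs_ev_neq0 rs lb0 nzb0.
  have [m [la nzm]] := reduced_lead_form q_gt1 n_gt1 sza nza.
  have lr := weight_le_polyC r; set d := (size r).-1 in lr.
  (* The weight of the numerator is at most that of the denominator [r], by comparison
     with the fraction [a0 / b0] that puts [z] in the ring at infinity. *)
  have le_md : (m <= d * Q)%N.
    rewrite leqNgt; apply/negP => lt_dm.
    have lar : weight_le q n (k + d * Q) (a0 * r%:P) by apply: weight_leM.
    have lar' : weight_le q n (m + k) (a0 * r%:P).
      by apply: weight_le_trans lar; rewrite addnC leq_add2r ltnW.
    have : lead_form q n (m + k) (a * b0 - a0 * r%:P) = 0.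
      apply: (rs_ev0 rs (weight_leB (weight_leM la lb0) lar')).
      apply/eqP; rewrite /= eval2B !eval2M subr_eq0 -eqr_div //; apply/eqP.
      by rewrite -zE' -zE.
    rewrite lead_formB lead_formM // (lead_form_small _ lar) ?subr0; last first.
      by rewrite addnC ltn_add2r.
    by move/eqP; rewrite mulf_eq0 (negPf nzm) (negPf nzb0).
  have {}la := weight_le_trans le_md la.
  rewrite zE' eval2E mulr_suml; apply: place_ring_sum => j _.
  rewrite horner_coef size_map_poly !mulr_suml; apply: place_ring_sum => i _.
  rewrite coef_map /=; have [->|nzc] := eqVneq a`_j`_i 0.
    by rewrite rmorph0 !mul0r place_ring0.
  have nx : x != 0 by apply: contraNneq nOx => ->; apply: place_ring0.
  have -> : ff_const F a`_j`_i * x ^+ i * y ^+ j / ev r%:P =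
     ff_const F a`_j`_i * (x ^+ i * y ^+ j / x ^+ d) * (x ^+ d / ev r%:P).
    by rewrite !mulrA divfK ?expf_neq0.
  rewrite place_ringM //; last by rewrite eval2C pole_inv_poly.
  rewrite place_ringM ?place_ring_const //.
  apply: (pole_monomial_ring q_gt1 n_gt1 model_curve nOx).
  by apply: (proj1 (@weight_leP K q n n_gt1 _ _) la).
- move=> m a sza nza.
  have [l [la nzl]] := reduced_lead_form q_gt1 n_gt1 sza nza.
  have -> : ev a = t ^ (- l%:Z) * (t ^+ l * ev a).
    by rewrite -exprnN mulKf // expf_neq0.
  rewrite residue_place_valuation; last exact: t_unit.
  rewrite addrC subr_ge0 lez_nat; split=> [le_lm|lma]; first exact: weight_le_trans la.
  exact: lead_form_unique_le lma nzl.
Qed.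
End InfinityPlace.

(** * Places at the affine points *)

Section Frobenius.
Variables (S : comNzRingType) (p m : nat).
Hypothesis (pS : p \in [pchar S]).
Local Notation s := (p ^ m)%N.

Lemma exprD_pchar (u v : S) : (u + v) ^+ s = u ^+ s + v ^+ s.
Proof.
apply: exprDn_pchar; rewrite pnatX; apply/orP; left.
by rewrite pnatE ?(pcharf_prime pS).
Qed.

Lemma exprB_pchar (u v : S) : (u - v) ^+ s = u ^+ s - v ^+ s.
Proof. by apply: (addIr (v ^+ s)); rewrite subrK -exprD_pchar subrK. Qed.

Lemma expr_sum_pchar (I : Type) (r : seq I) (P : pred I) (f : I -> S) :
  (\sum_(i <- r | P i) f i) ^+ s = \sum_(i <- r | P i) f i ^+ s.
Proof.
apply: (big_morph (fun u : S => u ^+ s)) => [u v|]; first exact: exprD_pchar.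
by rewrite expr0n gtn_eqF // expn_gt0 prime_gt0 // (pcharf_prime pS).
Qed.
End Frobenius.

Section TraceAdditive.
Variables (S : comNzRingType) (p e n : nat).
Hypothesis (pS : p \in [pchar S]).
Local Notation q := (p ^ e)%N.

Lemma trace_powB (u v : S) : trace_pow q n (u - v) = trace_pow q n u - trace_pow q n v.
Proof.
rewrite /trace_pow -sumrB; apply: eq_bigr => j _.
by rewrite -expnM exprB_pchar.
Qed.

Lemma trace_powX (u : S) m : trace_pow q n (u ^+ (p ^ m)) = trace_pow q n u ^+ (p ^ m).
Proof.
by rewrite /trace_pow expr_sum_pchar //; apply: eq_bigr => j _; rewrite exprAC.
Qed.
End TraceAdditive.

(** The point [(x0, y0)] may have coordinates in any field [K'] in which they are fixed by
    the Frobenius power [u |-> u ^ s], where [s] is such that the constants are fixed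
    too.  Then [x ^ s - x] is a uniformizer at that point: its derivative is [-1], and the
    projection to the [x]-line is unramified because the derivative of the trace
    polynomial is [1]. *)
Section AffinePlace.
Variables (K : finFieldType) (p e n : nat) (F : functionField K) (x y : F).
Local Notation q := (p ^ e)%N.
Hypotheses (pK : p \in [pchar K]) (q_gt1 : (1 < q)%N) (n_gt1 : (1 < n)%N).
Hypothesis model : curve_model q n (ff_const F) x y.

Local Notation R := {poly {poly K}}.
Local Notation Q := (q ^ n.-1)%N.
Local Notation M := (trace_exp q n).
Local Notation h := (curve_poly K q n).
Local Notation ev := (eval2 (ff_const F) x y).

Variables (K' : fieldType) (iota : {rmorphism K -> K'}) (x0 y0 : K') (m : nat).
Hypothesis curve_x0y0 : trace_pow q n y0 = x0 ^+ M.
Local Notation s := (p ^ m)%N.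
Hypotheses (m_gt0 : (0 < m)%N) (Ks : forall c : K, c ^+ s = c).
Hypotheses (x0s : x0 ^+ s = x0) (y0s : y0 ^+ s = y0).
Local Notation phi := (eval2 iota x0 y0).

Let pR : p \in [pchar R].
Proof. exact: (rmorph_pchar (polyC \o polyC)). Qed.

Let pF : p \in [pchar F].
Proof. exact: (rmorph_pchar (ff_const F)). Qed.

Let s_gt1 : (1 < s)%N.
Proof. by rewrite -{1}(expn0 p) ltn_exp2l // prime_gt1 // (pcharf_prime pK). Qed.

Local Notation X := ('X%:P : R).
Local Notation tau := (('X^s - 'X)%:P : R).
Local Notation eta := ('X^s - 'X : R).

(** Since [u |-> u ^ s] is an endomorphism that fixes the constants, the [a] for which this
    holds form a subring containing [x] and [y]. *)
Lemma frobenius_ideal (a : R) : exists b c, a ^+ s - a = b * tau + c * eta.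
Proof.
pose J (a : R) := exists b c, a ^+ s - a = b * tau + c * eta.
have JD u v : J u -> J v -> J (u + v).
  move=> [b [c E]] [b' [c' E']]; exists (b + b'), (c + c').
  have alg (b1 c1 b2 c2 t w : R) : (b1 * t + c1 * w) + (b2 * t + c2 * w) =
      (b1 + b2) * t + (c1 + c2) * w by rewrite !mulrDl addrACA.
  by rewrite exprD_pchar // opprD addrACA E E' alg.
have JM u v : J u -> J v -> J (u * v).
  move=> [b [c E]] [b' [c' E']]; exists (u ^+ s * b' + v * b), (u ^+ s * c' + v * c).
  have -> : (u * v) ^+ s - u * v = u ^+ s * (v ^+ s - v) + v * (u ^+ s - u).
    by rewrite exprMn !mulrBr [v * u ^+ s]mulrC addrA subrK [v * u]mulrC.
  have alg (A B b1 c1 b2 c2 t w : R) : A * (b2 * t + c2 * w) + B * (b1 * t + c1 * w) =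
      (A * b2 + B * b1) * t + (A * c2 + B * c1) * w.
    by rewrite !mulrDr !mulrDl -!mulrA addrACA.
  by rewrite E E' alg.
have JY : J 'X by exists 0, 1; rewrite mul0r mul1r add0r.
have JX : J 'X%:P by exists 1, 0; rewrite mul0r mul1r addr0 polyCB polyC_exp.
have JK c : J c%:P%:P by exists 0, 0; rewrite -!polyC_exp Ks subrr !mul0r addr0.
elim/poly_ind: a => [|a r IH]; first by rewrite -!polyC0; apply: JK.
apply: (JD); first exact: JM.
elim/poly_ind: r => [|r c IHr]; first by rewrite -polyC0; apply: JK.
by rewrite polyCD polyCM; apply: JD => //; apply: JM.
Qed.

Lemma phi_tau : phi tau = 0.
Proof. by rewrite eval2C rmorphB /= map_polyXn map_polyX !hornerE x0s subrr. Qed.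

Lemma phi_eta : phi eta = 0.
Proof. by rewrite eval2B eval2Xn eval2X y0s subrr. Qed.

Local Notation U := (\sum_(j < n) eta ^+ (q ^ j - 1)).
Local Notation W := (\sum_(i < M) (X ^+ s) ^+ (M.-1 - i) * X ^+ i).

Lemma phi_U : phi U = 1.
Proof.
rewrite eval2_sum; case: n n_gt1 => // n' _; rewrite big_ord_recl big1 => [|j _].
  by rewrite addr0 expn0 subnn expr0 eval2_1.
rewrite eval2Xn phi_eta expr0n subn_eq0 leqNgt -{1}(expn0 q) ltn_exp2l //.
Qed.

(** Additivity of the trace gives [Tr (y ^ s - y) = x ^ (M s) - x ^ M] on the curve; the left
    side is divisible by [y ^ s - y] with a cofactor of value [1] at the point, the right
    side by [x ^ s - x].  So [y ^ s - y] may be traded for [x ^ s - x]. *)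
Lemma ev_eta_U : ev (eta * U) = ev (tau * W).
Proof.
have -> : eta * U = trace_pow q n eta.
  rewrite mulr_sumr; apply: eq_bigr => j _; rewrite -exprS subn1 prednK //.
  by rewrite expn_gt0 ltnW.
have -> : tau * W = (X ^+ s) ^+ M - X ^+ M.
  by rewrite subrXX polyCB polyC_exp.
rewrite eval2_trace !eval2B !eval2Xn eval2X trace_powB // trace_powX //.
have [ev_h _ _] := model; rewrite (model_curve model).
by rewrite eval2CX exprAC.
Qed.

(** The maximal ideal is generated by [x ^ s - x] locally: if [a] vanishes at the point, then
    [a - a ^ s] is [a] times an element of value [1], and [frobenius_ideal] and
    [ev_eta_U] put it in the ideal of [x ^ s - x], up to a cofactor of value [1]. *)
Lemma vanishing_step (a : R) : phi a = 0 ->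
  exists g b : R, phi g = 1 /\ ev (g * a) = ev (tau * b).
Proof.
move=> a0; have [b [c E]] := frobenius_ideal a.
exists (U * (1 - a ^+ s.-1)), (- (U * b + c * W)); split.
  rewrite eval2M phi_U mul1r eval2B eval2_1 eval2Xn a0 expr0n.
  by rewrite -subn1 subn_eq0 leqNgt s_gt1 subr0.
have -> : U * (1 - a ^+ s.-1) * a = - (U * (b * tau) + c * (eta * U)).
  rewrite -mulrA mulrBl mul1r -exprSr prednK ?(ltnW s_gt1) // -[a - _]opprB E.
  by rewrite mulrN mulrDr [c * (_ * _)]mulrA [_ * U]mulrC.
have -> : tau * - (U * b + c * W) = - (U * (b * tau) + c * (tau * W)).
  by rewrite mulrN mulrDr mulrCA [tau * b]mulrC [tau * (c * W)]mulrCA.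
by rewrite !eval2N !eval2D ![ev (c * _)]eval2M ev_eta_U.
Qed.

(** While [c] vanishes at [x0], it shares with [X ^ s - X] a factor [d] that vanishes there;
    the cofactor of [d] in [X ^ s - X] does not, because the derivative of
    [X ^ s - X] is [-1]. *)
Lemma polyX_order (c : {poly K}) : c != 0 -> exists k (g d : {poly K}),
  [/\ phi g%:P != 0, phi d%:P != 0 & g * c = ('X^s - 'X) ^+ k * d].
Proof.
have [N] := ubnP (size c); elim: N c => // N IH c; rewrite ltnS => szc nzc.
have [c0|nz] := eqVneq (phi c%:P) 0; last first.
  by exists 0%N, 1, c; rewrite polyC1 eval2_1 oner_neq0 mul1r.
pose d := gcdp c ('X^s - 'X).
have rootc : root (map_poly iota c) x0 by apply/rootP; rewrite -(eval2C iota x0 y0).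
have roott : root (map_poly iota ('X^s - 'X)) x0.
  by apply/rootP; rewrite -(eval2C iota x0 y0) phi_tau.
have rootd : root (map_poly iota d) x0 by rewrite gcdp_map root_gcd rootc.
have nzd : d != 0 by rewrite gcdp_eq0 negb_and nzc.
have [/dvdpP[c1 cE] /dvdpP[t1 tE]] : d %| c /\ d %| 'X^s - 'X.
  by rewrite dvdp_gcdl dvdp_gcdr.
have nzc1 : c1 != 0 by apply: contraNneq nzc => c10; rewrite cE c10 mul0r.
have sz1d : (1 < size d)%N.
  by rewrite -(size_map_poly iota); apply: root_size_gt1 rootd; rewrite map_poly_eq0.
have t1nz : phi t1%:P != 0.
  have : (map_poly iota ('X^s - 'X)^`()).[x0] = -1.
    rewrite derivB derivXn derivX -mulr_natr.
    have -> : s%:R = 0 :> {poly K}.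
      have pP : p \in [pchar {poly K}] by apply: (rmorph_pchar polyC).
      by rewrite natrX (pcharf0 pP) expr0n -leqn0 leqNgt m_gt0.
    by rewrite mulr0 sub0r rmorphN rmorph1 hornerN hornerC.
  rewrite tE derivM rmorphD !rmorphM hornerD !hornerM /=.
  rewrite (rootP rootd) mulr0 add0r => E; rewrite eval2C.
  apply/eqP => t10; move/eqP: E; rewrite t10 mul0r eq_sym oppr_eq0.
  by rewrite oner_eq0.
have [|k [g [c' [nzg nzc' E]]]] := IH c1 _ nzc1.
  rewrite (leq_trans _ szc) // cE size_mul //.
  have ar A B : (0 < A -> 1 < B -> A < (A + B).-1)%N by clear; lia.
  by apply: ar; rewrite ?size_poly_gt0.
exists k.+1, (g * t1), c'; split; [|exact: nzc'|].
  by rewrite polyCM eval2M; apply: mulf_neq0.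
rewrite exprS -[RHS]mulrA -E tE cE.
by rewrite [g * t1]mulrC [c1 * d]mulrC mulrACA.
Qed.

(** If [vanishing_step] could be iterated forever, then all powers of [x ^ s - x] would
    divide, locally, a multiple of [a] in [K[x]], against [polyX_order]. *)
Lemma curve_order (a : R) : ev a != 0 -> exists k (g b : R),
  [/\ phi g != 0, phi b != 0 & ev g * ev a = ev tau ^+ k * ev b].
Proof.
move=> nza; have [ev_h ev_ker ev_frac] := model.
have nztau : ev tau != 0.
  apply: (ev_polyC_neq0 q_gt1 n_gt1 ev_ker).
  by rewrite -size_poly_eq0 size_polyDl size_polyXn // size_polyN size_polyX.
apply: contrapT => no.
have descend k : exists g b : R, phi g != 0 /\ ev g * ev a = ev tau ^+ k * ev b.
  elim: k => [|k [g [b [nzg E]]]].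
    by exists 1, a; rewrite eval2_1 oner_neq0 eval2_1 expr0 !mul1r.
  have [b0|nzb] := eqVneq (phi b) 0; last by case: no; exists k, g, b.
  have [g' [b' [g'1 E']]] := vanishing_step b0.
  exists (g' * g), b'; split; first by rewrite eval2M g'1 mul1r.
  by rewrite eval2M -mulrA E mulrCA -eval2M E' eval2M mulrA exprSr.
have [b [r [nzr bE]]] := ev_frac (ev a)^-1.
have nzer := ev_polyC_neq0 q_gt1 n_gt1 ev_ker nzr.
have abE : ev a * ev b = ev r%:P.
  by rewrite -[ev b](divfK nzer) -bE mulVKf.
have [k [g0 [r1 [nzg0 nzr1 E0]]]] := polyX_order nzr.
have [g [a' [nzg E]]] := descend k.+1.
have : ev (g * r1%:P) = ev (tau * (a' * b * g0%:P)).
  apply: (mulfI (expf_neq0 k nztau)); rewrite !eval2M.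
  have := congr1 (fun u : {poly K} => ev u%:P) E0.
  rewrite !polyCM polyC_exp !eval2M eval2Xn => E0'.
  by rewrite mulrCA -E0' -abE [ev g0%:P * _]mulrC !mulrA E exprSr.
move/eqP; rewrite -subr_eq0 -eval2B => /eqP/ev_ker[c /(congr1 phi)].
rewrite [phi (c * _)]eval2M eval2_curve curve_x0y0 subrr mulr0 eval2B !eval2M phi_tau mul0r subr0.
by move/eqP; rewrite mulf_eq0 (negPf nzg) (negPf nzr1).
Qed.

Lemma affine_place_exists : exists P : place F,
  [/\ forall z, z \in place_ring P <-> exists a b, phi b != 0 /\ z = ev a / ev b,
      forall z, z \in place_ideal P <->
        exists a b, [/\ phi a = 0, phi b != 0 & z = ev a / ev b]
    & forall z, z != 0 -> 0 <= valuation P z -> z \in place_ring P].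
Proof.
have [ev_h ev_ker ev_frac] := model.
pose wle (_ : nat) (_ : R) := True; pose lf (_ : nat) (a : R) := phi a.
have phi_ker a : ev a = 0 -> phi a = 0.
  by move=> /ev_ker[c ->]; rewrite eval2M eval2_curve curve_x0y0 subrr mulr0.
have rs : @residue_system R F K' (ev : {rmorphism R -> F}) wle lf.
  split=> //; try by move=> *; rewrite /lf ?eval2B ?eval2M ?eval2_1.
  by move=> k a _ /phi_ker.
pose t := ev tau.
have nzt : t != 0.
  apply: (ev_polyC_neq0 q_gt1 n_gt1 ev_ker).
  by rewrite -size_poly_eq0 size_polyDl size_polyXn // size_polyN size_polyX.
have It : @rs_ideal R F K' (ev : {rmorphism R -> F}) wle lf t.
  exists 0%N, tau, 1; split=> //; first by rewrite /lf eval2_1 oner_neq0.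
  by rewrite /lf phi_tau /= eval2_1 divr1.
have nz_ev b : phi b != 0 -> ev b != 0 by apply: contraNneq => /phi_ker ->.
have t_exp (z : F) : z != 0 -> exists (k : int) u,
    @rs_unit R F K' (ev : {rmorphism R -> F}) wle lf u /\ z = t ^ k * u.
  have [a [r [nzr ->]]] := ev_frac z.
  rewrite mulf_eq0 invr_eq0 negb_or => /andP[nza nzer].
  have [k [g [b [nzg nzb E]]]] := curve_order nza.
  have [l [g' [b' [nzg' nzb' E']]]] := curve_order nzer.
  exists (k%:Z - l%:Z), (ev (g' * b) / ev (g * b')); split.
    exists 0%N, (g' * b), (g * b'); split=> //; first by rewrite /lf eval2M mulf_neq0.
    by split=> //; rewrite /lf eval2M mulf_neq0.
  have aE : ev a = (ev g)^-1 * (t ^+ k * ev b) by rewrite -E mulKf ?nz_ev.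
  have rE : ev r%:P = (ev g')^-1 * (t ^+ l * ev b') by rewrite -E' mulKf ?nz_ev.
  have tE := exprz_subn k l nzt.
  rewrite tE aE rE !eval2M !invfM invrK.
  have alg (A B u v w z' : F) : u * (A * v) * (w * (B * z')) = A * B * (w * v * (u * z')).
    by rewrite mulrACA [A * v * _]mulrACA mulrCA [u * w]mulrC [w * v * _]mulrACA.
  exact: alg.
pose cst : {rmorphism K -> R} := polyC \o polyC.
have ev_cst c : ev (cst c) = ff_const F c by apply: eval2CC.
have cst_le c : wle 0%N (cst c) by [].
exists (@residue_place K F K' R (ev : {rmorphism R -> F}) wle lf cst rs cst_le ev_cst t
  It nzt t_exp).
split=> z.
- split=> [/residue_place_ringP[k [a [b [_ _ nzb zE]]]]|[a [b [nzb zE]]]].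
    by exists a, b.
  by apply/residue_place_ringP; exists 0%N, a, b.
- split=> [/residue_place_idealP[k [a [b [_ _ nzb [zE a0]]]]]|[a [b [a0 nzb zE]]]].
    by exists a, b.
  by apply/residue_place_idealP; exists 0%N, a, b.
- move=> /t_exp[k [u [Uu ->]]]; rewrite residue_place_valuation // => k_ge0.
  case: k k_ge0 => // k _; apply: place_ringM; last exact/residue_place_ringP/rs_unit_ring.
  by apply/place_ringX/residue_place_ringP/rs_ideal_ring.
Qed.
End AffinePlace.

(** * Finite fields and their extensions *)

Section FiniteField.
Variable K : finFieldType.

(** Multiplication by [u != 0] permutes the factors of the product of the nonzero
    elements. *)
Lemma expf_card_finField (u : K) : u ^+ #|K| = u.
Proof.
have [->|nzu] := eqVneq u 0.
  by rewrite expr0n gtn_eqF //; apply/card_gt0P; exists 0.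
have cardK : #|K| = #|[pred v : K | v != 0]|.+1.
  rewrite (cardD1 0) inE add1n; congr _.+1; apply: eq_card => v.
  by rewrite !inE andbT.
have nzprod : \prod_(v : K | v != 0) v != 0 by apply/prodf_neq0.
rewrite cardK exprS -[RHS]mulr1; congr (_ * _).
apply: (mulIf nzprod); rewrite mul1r [RHS](reindex_onto (fun v => u * v) (fun v => u^-1 * v)) /=.
  under [RHS]eq_bigl => v do rewrite mulf_eq0 (negPf nzu) mulKf // eqxx andbT.
  by rewrite big_split /= prodr_const.
by move=> v _; rewrite mulVKf.
Qed.

(** The translation [v |-> v + 1] permutes the terms of the sum of all elements. *)
Lemma pchar_card_finField p m : prime p -> #|K| = (p ^ m)%N -> p \in [pchar K].
Proof.
move=> prp cardK; have : (#|K|)%:R = 0 :> K.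
  apply: (addrI (\sum_(v : K) v)); rewrite addr0 [in RHS](reindex_onto (fun v => v + 1)
    (fun v => v - 1)) /=.
    under [RHS]eq_bigl => v do rewrite addrK eqxx.
    by rewrite big_split /= sumr_const.
  by move=> v _; rewrite subrK.
rewrite cardK natrX => /eqP; rewrite expf_eq0 => /andP[_ p0].
by rewrite inE prp.
Qed.

(** A divisor of [X ^ #|K| - X] is a product of distinct linear factors. *)
Lemma card_roots_split (f : {poly K}) : f %| 'X^#|K| - 'X -> f != 0 ->
  #|[set u | root f u]| = (size f).-1.
Proof.
move=> dvdf nzf; have cardK_gt1 : (1 < #|K|)%N by apply/card_gt1P; exists 0, 1;
  rewrite eq_sym oner_neq0.
have splitX : 'X^#|K| - 'X = \prod_(u <- enum K) ('X - u%:P).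
  have szX : size ('X^#|K| - 'X : {poly K}) = #|K|.+1.
    by rewrite size_polyDl size_polyXn // size_polyN size_polyX.
  rewrite [LHS](@all_roots_prod_XsubC _ _ (enum K)) ?szX -?cardE //.
  - rewrite lead_coefDl ?size_polyXn ?size_polyN ?size_polyX // lead_coefXn scale1r.
    by [].
  - by apply/allP => u _; rewrite rootE !hornerE expf_card_finField subrr.
  - by rewrite uniq_rootsE enum_uniq.
move: dvdf; rewrite splitX => /dvdp_prod_XsubC[mk fE].
rewrite (eqp_size fE) size_prod_XsubC /=.
rewrite -(card_uniqP _); last by rewrite mask_uniq // enum_uniq.
apply: eq_card => u; rewrite inE (eqp_root fE) -root_prod_XsubC //.
Qed.
End FiniteField.

Lemma root_min_poly (K L : fieldType) (iota : {rmorphism K -> L}) (x0 : L) (r : {poly K}) :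
  r != 0 -> root (map_poly iota r) x0 ->
  exists2 d : {poly K}, (1 < size d)%N & forall u, root (map_poly iota u) x0 -> d %| u.
Proof.
move=> nzr rootr.
have ex : exists k, `[< exists2 d : {poly K}, root (map_poly iota d) x0 & size d = k.+1 >].
  exists (size r).-1; apply/asboolP; exists r; rewrite ?prednK ?size_poly_gt0 //.
case: (ex_minnP ex) => k /asboolP[d rootd szd] min_k.
have nzd : d != 0 by rewrite -size_poly_eq0 szd.
exists d => [|u rootu].
  by rewrite -(size_map_poly iota); apply: root_size_gt1 rootd; rewrite map_poly_eq0.
apply: contraT => ndvd; have nzm : u %% d != 0 by [].
have rootm : root (map_poly iota (u %% d)) x0.
  move: rootu; rewrite {1}(divp_eq u d) rmorphD rmorphM /root hornerD hornerM /=.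
  by rewrite (rootP rootd) mulr0 add0r.
have lt_vd : (size (u %% d)%R < k.+1)%N by rewrite -szd ltn_modp.
have le_kv : (k <= (size (u %% d)%R).-1)%N.
  by apply: min_k; apply/asboolP; exists (u %% d) => //; rewrite prednK ?size_poly_gt0.
have := nzm; rewrite -size_poly_gt0; move: lt_vd le_kv; case: (size _) => // l.
by rewrite ltnS /= => lt_lk /(leq_trans lt_lk); rewrite ltnn.
Qed.

Lemma irreducible_factor (K : fieldType) (f : {poly K}) : (1 < size f)%N ->
  exists2 d : {poly K}, irreducible_poly d & d %| f.
Proof.
move=> sz1f.
have ex : exists k, `[< exists2 d : {poly K}, d %| f & size d = k.+2 >].
  exists (size f).-2; apply/asboolP; exists f => //.
  by case: (size f) sz1f => [|[]].
case: (ex_minnP ex) => k /asboolP[d dvd szd] min_k; exists d => //.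
split=> [|u sz1u dvdu]; first by rewrite szd.
have nzd : d != 0 by rewrite -size_poly_eq0 szd.
have nzu : u != 0 by apply: contraNneq nzd => u0; move: dvdu; rewrite u0 dvd0p.
rewrite -dvdp_size_eqp // eqn_leq dvdp_leq //= szd.
have szu : size u = (size u).-2.+2.
  by move: sz1u; rewrite -size_poly_eq0 in nzu; move: nzu; case: (size u) => [|[]].
rewrite szu !ltnS; apply: min_k; apply/asboolP; exists u => //.
exact: dvdp_trans dvd.
Qed.

(** Finiteness as a property, for the fields that a field extension produces without an
    enumeration. *)
Definition finitely_many (L : Type) : Prop :=
  exists (T : finType) (f : L -> T), injective f.

Lemma finite_root_extension (L : fieldType) (f : {poly L}) :
  finitely_many L -> (1 < size f)%N ->
  exists (L' : fieldType) (iota : {rmorphism L -> L'}) (z : L'),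
    finitely_many L' /\ root (map_poly iota f) z.
Proof.
move=> [T [c inj_c]] /irreducible_factor[d irr_d dvd_df].
have [L' _ [z rootz _]] := irredp_FAdjoin irr_d.
exists L', (in_alg L'), z; split; last first.
  by have /dvdpP[w ->] := dvd_df; rewrite rmorphM rootM /= rootz orbT.
pose b := vbasis (fullv : {vspace L'}).
exists {ffun 'I_(\dim (fullv : {vspace L'})) -> T}, (fun u : L' => [ffun i => c (coord b i u)]).
move=> u v /ffunP eq_uv; rewrite (coord_vbasis (memvf u)) (coord_vbasis (memvf v)).
by apply: eq_bigr => i _; congr (_ *: _); apply: inj_c; have := eq_uv i; rewrite !ffunE.
Qed.

(** The injective map [v |-> v ^ (p ^ m)] has finite orbits. *)
Lemma frobenius_periodic (L : fieldType) (p m : nat) (u : L) :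
  finitely_many L -> p \in [pchar L] -> exists2 k, (0 < k)%N & u ^+ (p ^ (m * k)) = u.
Proof.
move=> [T [c inj_c]] pL.
have inj_frob j : injective (fun v : L => v ^+ (p ^ j)).
  move=> v w /eqP; rewrite -subr_eq0 -exprB_pchar // expf_eq0 subr_eq0 => /andP[_ /eqP].
  by [].
have /injectivePn[i [j neij eqij]] :
    ~~ injectiveb (fun i : 'I_(#|T|.+1) => c (u ^+ (p ^ (m * i)))).
  apply/negP => /injectiveP /leq_card; by rewrite card_ord ltnn.
wlog lt_ij : i j neij eqij / (i < j)%N.
  move=> IH; case: (ltngtP i j) => [lt|lt|/val_inj eq]; first exact: IH lt.
    by apply: IH lt; rewrite 1?eq_sym.
  by rewrite eq eqxx in neij.
exists (j - i)%N; first by rewrite subn_gt0.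
apply: (inj_frob (m * i)%N); move/inj_c: eqij => ->.
by rewrite -exprM -expnD -mulnDr subnK // ltnW.
Qed.

(** * Rational points of the curve *)

(** Raising to the power [q] shifts the terms of the trace by one, so that the difference
    telescopes. *)
Lemma trace_pow_frobenius (S : comNzRingType) (p e n : nat) (u : S) :
  p \in [pchar S] -> let q := (p ^ e)%N in
  trace_pow q n u ^+ q - trace_pow q n u = u ^+ (q ^ n) - u.
Proof.
move=> pS q; rewrite /trace_pow expr_sum_pchar //.
under eq_bigr => j _ do rewrite -exprM -expnSr.
elim: n => [|n' IH]; first by rewrite !big_ord0 expn0 expr1 !subrr.
by rewrite !big_ord_recr /= opprD addrACA IH addrC addrA subrK.
Qed.

Section CurvePoints.
Variables (K : finFieldType) (p e n : nat).
Local Notation q := (p ^ e)%N.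
Hypotheses (p_pr : prime p) (q_gt1 : (1 < q)%N) (n_gt1 : (1 < n)%N).
Hypothesis (cardK : #|K| = (q ^ n)%N).
Local Notation Q := (q ^ n.-1)%N.
Local Notation M := (trace_exp q n).

Lemma pcharK : p \in [pchar K].
Proof. by apply: (@pchar_card_finField _ p (e * n)); rewrite // expnM. Qed.

Lemma size_trace_poly (L : fieldType) (c : L) :
  size (trace_pow q n 'X - c%:P) = Q.+1.
Proof.
rewrite /trace_pow; case: n n_gt1 => // n' n'_gt0; rewrite big_ord_recr /= addrAC addrC.
rewrite size_polyDl size_polyXn // ltnS (leq_trans (size_polyD _ _)) // geq_max.
have Q_gt0 : (0 < q ^ n')%N by rewrite expn_gt0 ltnW.
rewrite size_polyN; apply/andP; split; last exact: leq_trans (size_polyC_leq1 _) Q_gt0.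
apply: (leq_trans (size_sum _ _ _)); apply/bigmax_leqP => j _.
by have := ltn_ord j; rewrite size_polyXn ltn_exp2l.
Qed.

(** By [trace_pow_frobenius] the polynomial [f = Tr X - c] satisfies
    [f ^ q - f = X ^ #|K| - X], hence divides [X ^ #|K| - X]. *)
Lemma card_trace_fiber (c : K) : c ^+ q = c ->
  #|[set y | trace_pow q n y == c]| = Q.
Proof.
move=> cq; set f : {poly K} := trace_pow q n 'X - c%:P.
have szf : size f = Q.+1 by apply: size_trace_poly.
have -> : Q = (size f).-1 by rewrite szf.
rewrite -card_roots_split; last by rewrite -size_poly_eq0 szf.
- apply: eq_card => y; rewrite !inE /root /f hornerD hornerN hornerC subr_eq0.
  by rewrite /trace_pow horner_sum; under [in RHS]eq_bigr => j _ do rewrite hornerXn.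
have pP : p \in [pchar {poly K}] by apply: (rmorph_pchar polyC) pcharK.
have -> : 'X^#|K| - 'X = f ^+ q - f.
  rewrite cardK -(trace_pow_frobenius e n 'X pP) /f exprB_pchar // -polyC_exp cq.
  by rewrite opprB addrA subrK.
have -> : f ^+ q - f = (f ^+ (q - 1) - 1) * f.
  by rewrite mulrBl mul1r -exprSr subn1 prednK // ltnW.
exact: dvdp_mull.
Qed.

(** Here [c ^ (q - 1) = 1] and [M * (q - 1) = #|K| - 1], so that [X ^ M - c] divides
    [X ^ (#|K| - 1) - 1]. *)
Lemma card_norm_fiber (c : K) : c != 0 -> c ^+ q = c ->
  #|[set x | x ^+ M == c]| = M.
Proof.
move=> nzc cq; set f : {poly K} := 'X^M - c%:P.
have M_gt0 := trace_exp_gt0 q n_gt1.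
have szf : size f = M.+1 by rewrite size_XnsubC.
transitivity (size f).-1; last by rewrite szf.
rewrite -card_roots_split; last by rewrite -size_poly_eq0 szf.
  by apply: eq_card => y; rewrite !inE /root /f !hornerE subr_eq0.
have c1 : c ^+ (q - 1) = 1.
  by apply: (mulfI nzc); rewrite -exprS mulr1 subn1 prednK // ltnW.
have -> : 'X^#|K| - 'X = 'X * (('X^M) ^+ (q - 1) - c%:P ^+ (q - 1)) :> {poly K}.
  rewrite -polyC_exp c1 -exprM trace_exp_mul // mulrBr mulr1 -exprS cardK subn1 prednK //.
  by rewrite expn_gt0 ltnW.
by rewrite subrXX mulrCA dvdp_mulr.
Qed.

Lemma norm_expq (u : K) : (u ^+ M) ^+ q = u ^+ M.
Proof.
have M_gt0 := trace_exp_gt0 q n_gt1.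
rewrite -exprM; have -> : (M * q = M.-1 + q ^ n)%N.
  have := trace_exp_mul q n; rewrite mulnBr muln1.
  have : (0 < q ^ n)%N by rewrite expn_gt0 ltnW.
  have : (M <= M * q)%N by rewrite leq_pmulr // ltnW.
  by move: M_gt0; lia.
by rewrite exprD -cardK expf_card_finField -exprSr prednK.
Qed.

Lemma trace_expq (u : K) : trace_pow q n u ^+ q = trace_pow q n u.
Proof.
apply/eqP; rewrite -subr_eq0 (trace_pow_frobenius e n u pcharK) -cardK.
by rewrite expf_card_finField subrr.
Qed.

Definition curve_points : {set K * K} :=
  [set P : K * K | trace_pow q n P.2 == P.1 ^+ M].

(** Above each of the [q ^ n] values of [x] there is a full fibre of the trace. *)
Lemma card_curve_points : #|curve_points| = (q ^ (2 * n - 1))%N.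
Proof.
rewrite -sum1dep_card (eq_bigl (fun P : K * K => xpredT P.1 && (trace_pow q n P.2 == P.1
  ^+ M))) //.
rewrite -(pair_big_dep xpredT (fun x y => trace_pow q n y == x ^+ M) (fun _ _ => 1%N)) /=.
under eq_bigr => x _ do rewrite sum1dep_card card_trace_fiber ?norm_expq //.
rewrite sum_nat_const cardK -expnD; congr (_ ^ _)%N.
by move: n_gt1; clear; lia.
Qed.
End CurvePoints.

(** * Functions without affine poles *)

Section AffineRegular.
Variables (K : finFieldType) (p e n : nat) (F : functionField K) (x y : F).
Local Notation q := (p ^ e)%N.
Hypotheses (p_pr : prime p) (q_gt1 : (1 < q)%N) (n_gt1 : (1 < n)%N).
Hypothesis (cardK : #|K| = (q ^ n)%N).
Hypothesis model : curve_model q n (ff_const F) x y.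

Local Notation R := {poly {poly K}}.
Local Notation Q := (q ^ n.-1)%N.
Local Notation M := (trace_exp q n).
Local Notation ev := (eval2 (ff_const F) x y).

Lemma expf_card_exp (c : K) k : c ^+ (p ^ (e * n * k)) = c.
Proof.
rewrite expnM [(p ^ _)%N]expnM -cardK; elim: k => [|k IH]; first by rewrite expn0 expr1.
by rewrite expnS exprM expf_card_finField.
Qed.

Lemma point_above_root (r : {poly K}) : (1 < size r)%N ->
  exists (L : fieldType) (iota : {rmorphism K -> L}) (x0 y0 : L) (m : nat),
  [/\ root (map_poly iota r) x0, trace_pow q n y0 = x0 ^+ M, (0 < m)%N
    & [/\ forall c : K, c ^+ (p ^ m) = c, x0 ^+ (p ^ m) = x0 & y0 ^+ (p ^ m) = y0]].
Proof.
move=> sz1r; have finK : finitely_many K by exists K, id.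
have [L1 [i1 [x1 [finL1 rootx1]]]] := finite_root_extension finK sz1r.
have [|L2 [i2 [y0 [finL2 rooty0]]]] :=
  @finite_root_extension L1 (trace_pow q n 'X - (x1 ^+ M)%:P) finL1.
  by rewrite size_trace_poly // ltnS expn_gt0 ltnW.
pose iota : {rmorphism K -> L2} := i2 \o i1.
have pL2 : p \in [pchar L2].
  by apply: (rmorph_pchar iota) (pcharK p_pr cardK).
pose x0 := i2 x1.
have [k k_gt0 x0k] := frobenius_periodic (e * n) x0 finL2 pL2.
have [l l_gt0 y0l] := frobenius_periodic (e * n * k) y0 finL2 pL2.
have e_gt0 : (0 < e)%N by move: q_gt1; case: e => //; rewrite expn0.
have perx j : x0 ^+ (p ^ (e * n * k * j)) = x0.
  rewrite expnM; elim: j => [|j IH]; first by rewrite expn0 expr1.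
  by rewrite expnS exprM x0k.
exists L2, iota, x0, y0, (e * n * k * l)%N; split.
- by rewrite map_poly_comp rmorph_root.
- move: rooty0; rewrite /root rmorphB rmorph_trace_pow /= map_polyC map_polyX /=.
  rewrite hornerD hornerN hornerC subr_eq0 rmorphXn => /eqP <-.
  by rewrite /trace_pow horner_sum; apply: eq_bigr => j _; rewrite hornerXn.
- by rewrite !muln_gt0 e_gt0 k_gt0 l_gt0 ltnW.
split=> // c; rewrite -mulnA; exact: expf_card_exp.
Qed.

(** The coordinate ring is integrally closed.  If a root [x0] of the denominator [r] is left,
    the [Q] points [(x0, y0 - b)], with [b] of trace zero, all lie on the curve, so that the
    numerator, of degree less than [Q] in [y], vanishes at [x = x0] identically.  Numerator
    and denominator are then divisible by the minimal polynomial of [x0]. *)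
Lemma affine_regular (z : F) :
  (forall P : place F, x \in place_ring P -> z != 0 -> 0 <= valuation P z) ->
  exists2 a : R, (size a <= Q)%N & z = ev a.
Proof.
move=> reg; have [z0|nzz] := eqVneq z 0.
  by exists 0; rewrite ?size_poly0 // eval2_0.
have [ev_h ev_ker ev_frac] := model.
have [a [r [sza nzr zE]]] := ev_frac_reduced q_gt1 n_gt1 ev_h ev_frac z.
have [N] := ubnP (size r); elim: N a r sza nzr zE => // N IH a r sza nzr zE.
rewrite ltnS => szr; have nzer := ev_polyC_neq0 q_gt1 n_gt1 ev_ker nzr.
have [sz1r|sz1r] := leqP (size r) 1.
  have [c rE] : exists c : K, r = c%:P by exists r`_0; apply: size1_polyC.
  exists (c^-1%:P%:P * a).
    by rewrite mul_polyC (leq_trans (size_scale_leq _ _)).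
  by rewrite zE eval2M eval2CC rE eval2CC fmorphV mulrC.
have [L [iota [x0 [y0 [m [rootr curve_x0y0 m_gt0 [Km x0m y0m]]]]]]] := point_above_root sz1r.
have pK := pcharK p_pr cardK.
have pL : p \in [pchar L] by apply: (rmorph_pchar iota).
pose A : {poly L} := map_poly (horner_eval x0 \o map_poly iota) a.
have A0 : A = 0.
  pose ys := [seq y0 - iota b | b <- enum [set b : K | trace_pow q n b == 0]].
  apply: (@roots_geq_poly_eq0 _ A ys).
  - apply/allP => w /mapP[b]; rewrite mem_enum inE => /eqP b0 {w}->.
    have cur : trace_pow q n (y0 - iota b) = x0 ^+ M.
      by rewrite trace_powB // -rmorph_trace_pow b0 rmorph0 subr0.
    have ym : (y0 - iota b) ^+ (p ^ m) = y0 - iota b.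
      by rewrite exprB_pchar // y0m -rmorphXn Km.
    have [P [ringP _ valP]] := affine_place_exists pK q_gt1 n_gt1 model iota cur m_gt0 Km x0m ym.
    have Ox : x \in place_ring P.
      by apply/ringP; exists 'X%:P, 1; rewrite !eval2_1 oner_neq0 eval2CX divr1.
    have /ringP[a1 [b1 [nzb1 zE1]]] := valP z nzz (reg P Ox nzz).
    have phi_ker u : ev u = 0 -> eval2 iota x0 (y0 - iota b) u = 0.
      by move=> /ev_ker[c ->]; rewrite eval2M eval2_curve cur subrr mulr0.
    have nzeb1 : ev b1 != 0 by apply: contraNneq nzb1 => /phi_ker ->.
    have : eval2 iota x0 (y0 - iota b) (a * b1 - a1 * r%:P) = 0.
      apply: phi_ker; apply/eqP; rewrite eval2B !eval2M subr_eq0 -eqr_div //.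
      by rewrite -zE -zE1.
    rewrite eval2B !eval2M [eval2 _ _ _ r%:P]eval2C (rootP rootr) mulr0 subr0.
    by move/eqP; rewrite mulf_eq0 (negPf nzb1) orbF /root.
  - rewrite map_inj_uniq ?enum_uniq // => b b' /addrI/oppr_inj; exact: fmorph_inj.
  - rewrite size_map -cardE card_trace_fiber ?expr0n ?gtn_eqF ?(ltnW q_gt1) //.
    by rewrite (leq_trans _ sza) // size_poly.
have [d sz1d min_d] := root_min_poly nzr rootr.
have nzd : d != 0 by rewrite -size_poly_gt0 ltnW.
have dvd_a j : d %| a`_j.
  apply: min_d; apply/rootP.
  have := congr1 (fun u : {poly L} => u`_j) A0.
  by rewrite coef_map coef0.
have [r' rE] := dvdpP _ _ (min_d _ rootr).
pose a' : R := \poly_(j < size a) (a`_j %/ d).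
have aE : a = d%:P * a'.
  apply/polyP => j; rewrite coefCM coef_poly; case: ltnP => [_|le_j].
    by rewrite mulrC divpK.
  by rewrite nth_default // mulr0.
have nzr' : r' != 0 by apply: contraNneq nzr => r0; rewrite rE r0 mul0r.
apply: (IH a' r') => //.
- by rewrite (leq_trans _ sza) // size_poly.
- have nzed := ev_polyC_neq0 q_gt1 n_gt1 ev_ker nzd.
  rewrite zE aE rE polyCM !eval2M [ev r'%:P * _]mulrC invfM mulrACA mulfV ?mul1r //.
- rewrite (leq_trans _ szr) // rE size_mul //.
  have ar B C : (0 < B -> 1 < C -> B < (B + C).-1)%N by clear; lia.
  by apply: ar; rewrite ?size_poly_gt0.
Qed.
End AffineRegular.

(** * The number of zeros of a function *)

Section ZeroCount.
Variables (K : fieldType) (q n : nat).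
Hypotheses (q_gt1 : (1 < q)%N) (n_gt1 : (1 < n)%N).

Local Notation R := {poly {poly K}}.
Local Notation Q := (q ^ n.-1)%N.
Local Notation M := (trace_exp q n).
Local Notation h := (curve_poly K q n).

Variables (d : nat) (pt : 'I_d -> K * K).
Hypothesis pt_curve : forall i, trace_pow q n (pt i).2 = (pt i).1 ^+ M.

Definition eval_at (i : 'I_d) (a : R) : K := eval2 idfun (pt i).1 (pt i).2 a.
Definition eval_row (a : R) : 'rV[K]_d := \row_i eval_at i a.

Lemma eval_at_curve i c : eval_at i (c * h) = 0.
Proof. by rewrite /eval_at eval2M eval2_curve pt_curve subrr mulr0. Qed.

Lemma eval_rowB a b : eval_row (a - b) = eval_row a - eval_row b.
Proof. by apply/rowP => i; rewrite !mxE /eval_at eval2B. Qed.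

Lemma eval_row_reduce a : exists2 b : R, (size b <= Q)%N &
  (exists c, a = c * h + b) /\ eval_row a = eval_row b.
Proof.
have [b szb [c aE]] := curve_reduce q_gt1 n_gt1 a; exists b => //; split; first by exists c.
by apply/rowP => i; rewrite !mxE aE /eval_at eval2D -/(eval_at i (c * h)) eval_at_curve add0r.
Qed.

Lemma eval_row_delta : injective pt -> forall i, exists a : R, eval_row a = delta_mx 0 i.
Proof.
move=> inj_pt i.
pose sep k : R := if (pt k).1 != (pt i).1 then 'X%:P - (pt k).1%:P%:P
                  else 'X - (pt k).2%:P%:P.
have sepE k l : eval_at l (sep k) =
    if (pt k).1 != (pt i).1 then (pt l).1 - (pt k).1 else (pt l).2 - (pt k).2.
  by rewrite /sep /eval_at; case: ifP => _; rewrite eval2B eval2CC ?eval2CX ?eval2X.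
pose a0 : R := \prod_(k | k != i) sep k.
have a0E l : eval_at l a0 = \prod_(k | k != i) eval_at l (sep k).
  exact: (rmorph_prod (eval2 idfun (pt l).1 (pt l).2 : {rmorphism R -> K})).
have nz : eval_at i a0 != 0.
  rewrite a0E; apply/prodf_neq0 => k neki; rewrite sepE.
  case: ifPn => [ne1|]; first by rewrite subr_eq0 eq_sym.
  rewrite negbK => /eqP eq1; rewrite subr_eq0; apply: contra neki => /eqP eq2.
  by apply/eqP/inj_pt; case: (pt k) (pt i) eq1 eq2 => [? ?] [? ?] /= -> ->.
exists ((eval_at i a0)^-1%:P%:P * a0); apply/rowP => l.
rewrite !mxE eqxx /eval_at eval2M eval2CC -!/(eval_at _ _) /=.
have [->|neli] := eqVneq l i; first by rewrite mulVf.
by rewrite [eval_at l a0]a0E (bigD1 l) //= sepE !subrr if_same mul0r mulr0.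
Qed.

(** The values at [d] zeros of [f] identify [K ^ d] with a quotient of the coordinate ring
    modulo [f].  Choose for each class modulo [m] a function [e r] of least weight in
    that class: a function of weight [s] equals, up to smaller weight, a scalar times
    [e r * f ^ j], which vanishes at the zeros unless [j = 0].  So the [m] functions
    [e r] span [K ^ d]. *)
Lemma zeros_le_weight (f : R) m : injective pt ->
  weight_le q n m f -> lead_form q n m f != 0 ->
  (forall i, eval_at i f = 0) -> (d <= m)%N.
Proof.
move=> inj_pt lf nzf f0.
have ex_min (r : 'I_m) : exists e : R, forall s (b : R),
    weight_le q n s b -> lead_form q n s b != 0 -> (s %% m)%N = r ->
    exists s0, [/\ (s0 <= s)%N, (s0 %% m)%N = r, weight_le q n s0 e & lead_form q n s0 e != 0].
  have [ex|no] := pselect (exists s, `[< exists b : R,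
      [/\ weight_le q n s b, lead_form q n s b != 0 & (s %% m)%N = r] >]); last first.
    by exists 0 => s b lb nzb sr; case: no; exists s; apply/asboolP; exists b.
  case: (ex_minnP ex) => s0 /asboolP[e [le nze s0r]] min_s0; exists e => s b lb nzb sr.
  by exists s0; split=> //; apply: min_s0; apply/asboolP; exists b.
have [e e_min] := choice ex_min.
pose B : 'M[K]_(m, d) := \matrix_(r < m) eval_row (e r).
(* The induction lowers the weight, whose top part is one-dimensional. *)
have span s : forall b : R, (size b <= Q)%N -> weight_le q n s b -> lead_form q n s b != 0 ->
    (eval_row b <= B)%MS.
  have [N] := ubnP s; elim: N s => // N IH s; rewrite ltnS => le_sN b szb lb nzb.
  (* A function of weight [0] is a nonzero constant and has no zeros. *)
  have [m0|m_gt0] := posnP m.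
    have b0 : eval_row b = 0.
      apply/rowP => i; have := f0 i.
      have fE : f = (f`_0`_0)%:P%:P.
        have far j k : f`_j`_k != 0 -> (k == 0%N) && (j == 0%N).
          move=> /((@weight_leP K q n n_gt1 m f).1 lf); rewrite m0 leqn0 addn_eq0 !muln_eq0.
          have Q_gt1 := expQ_gt1 q_gt1 n_gt1; have M_gt0 := trace_exp_gt0 q n_gt1.
          by rewrite (gtn_eqF M_gt0) (gtn_eqF (ltnW Q_gt1)) !orbF.
        apply/polyP => -[|j]; apply/polyP => -[|k]; rewrite !coefC //= ?coef0 //;
          by apply/eqP; apply: contraT => /far; rewrite ?andbF.
      rewrite fE /eval_at eval2CC /= => f00; move: nzf.
      by rewrite fE f00 !polyC0 /lead_form rmorph0 coef0 horner0 eqxx.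
    by rewrite b0 sub0mx.
  pose r : 'I_m := Ordinal (ltn_pmod s m_gt0).
  have [s0 [le_s0s s0r le0 nze]] := e_min r s b lb nzb erefl.
  have [j sE] : exists j, s = (s0 + j * m)%N.
    have : (m %| s - s0)%N by rewrite -eqn_mod_dvd // s0r.
    by case/dvdnP => j jE; exists j; rewrite -jE subnKC.
  have [lfj nzfj] : weight_le q n (j * m) (f ^+ j) /\ lead_form q n (j * m) (f ^+ j) != 0.
    elim: (j) => [|l [lfl nzfl]].
      rewrite expr0 mul0n; have := weight_le_const q n (1 : K).
      have := lead_form_const q n (1 : K).
      by rewrite !polyC1 => ->; rewrite oner_neq0.
    rewrite exprS mulSn; split; first exact: weight_leM.
    by rewrite lead_formM // mulf_neq0.
  pose c := lead_form q n s b / (lead_form q n s0 (e r) * lead_form q n (j * m) (f ^+ j)).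
  pose g := c%:P%:P * (e r * f ^+ j).
  have lg0 : weight_le q n s (e r * f ^+ j) by rewrite sE; apply: weight_leM.
  have lg : weight_le q n s g by rewrite -[s]add0n; apply: weight_leM;
    first exact: weight_le_const.
  have lgE : lead_form q n s g = lead_form q n s b.
    have := lead_formM (weight_le_const q n c) lg0; rewrite add0n lead_form_const => ->.
    by rewrite {1}sE lead_formM // /c divfK // mulf_neq0.
  have Eg : (eval_row g <= B)%MS.
    have -> : eval_row g = (c * 0 ^+ j) *: eval_row (e r).
      apply/rowP => i; rewrite !mxE /eval_at eval2M eval2CC eval2M eval2Xn.
      by rewrite -!/(eval_at _ _) f0 /= mulrA mulrAC.
    by apply: scalemx_sub; rewrite -(rowK (fun r => eval_row (e r)) r) row_sub.
  have -> : eval_row b = eval_row (b - g) + eval_row g by rewrite eval_rowB subrK.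
  apply: addmx_sub => //.
  have [b1 szb1 [[c1 b1E] ->]] := eval_row_reduce (b - g).
  have [->|nzb1] := eqVneq b1 0.
    have -> : eval_row 0 = 0 by apply/rowP => i; rewrite !mxE /eval_at eval2_0.
    exact: sub0mx.
  have [s1 [lb1 nzlb1]] := reduced_lead_form q_gt1 n_gt1 szb1 nzb1.
  have lt_s1s : (s1 < s)%N.
    rewrite ltnNge; apply/negP => le_ss1.
    have lbg : weight_le q n s1 (b - g).
      by apply: weight_le_trans le_ss1 _; apply: weight_leB.
    have : lead_form q n s1 (b - g - b1) = 0.
      apply: (lead_form_curve q_gt1 n_gt1 (c := c1)); first exact: weight_leB.
      by rewrite b1E addrK.
    rewrite lead_formB lead_formB; have [es|nes] := eqVneq s1 s.
      by rewrite es lgE subrr sub0r => /eqP; rewrite oppr_eq0 -es (negPf nzlb1).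
    have lt_ss1 : (s < s1)%N by rewrite ltn_neqAle eq_sym nes.
    rewrite (lead_form_small lt_ss1 lb) (lead_form_small lt_ss1 lg) subrr sub0r => /eqP.
    by rewrite oppr_eq0 (negPf nzlb1).
  by apply: IH lb1 nzlb1; rewrite ?(leq_trans lt_s1s).
have full : (1%:M <= B)%MS.
  apply/row_subP => i; rewrite row1.
  have [a <-] := eval_row_delta inj_pt i.
  have [b szb [_ ->]] := eval_row_reduce a.
  have [->|nzb] := eqVneq b 0.
    have -> : eval_row 0 = 0 by apply/rowP => k; rewrite !mxE /eval_at eval2_0.
    exact: sub0mx.
  have [s [lb nzlb]] := reduced_lead_form q_gt1 n_gt1 szb nzb.
  exact: span lb nzlb.
by have := mxrankS full; rewrite mxrank1 => /leq_trans; apply; apply: rank_leq_row.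
Qed.
End ZeroCount.

(** * Counting monomials *)

Section Count.
Variables (q n a : nat).
Hypotheses (q_gt1 : (1 < q)%N) (n_gt1 : (1 < n)%N).
Local Notation Q := (q ^ n.-1)%N.
Local Notation M := (trace_exp q n).
Hypotheses (a_gt0 : (0 < a)%N) (a_leQ : (a <= Q)%N).
Local Notation m := ((a - 1) * M)%N.

(** The first component is the exponent of [x] and the second that of [y]. *)
Definition monomial_exps : {set 'I_m.+1 * 'I_Q} :=
  [set ij : 'I_m.+1 * 'I_Q | (ij.1 * Q + ij.2 * M <= m)%N].

Lemma card_monomials_weight :
  #|monomial_exps| = (\sum_(i < a) ((i * M) %/ Q).+1)%N.
Proof.
have Q_gt0 : (0 < Q)%N by rewrite ltnW // expQ_gt1.
have M_gt0 := trace_exp_gt0 q n_gt1.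
rewrite -sum1dep_card (eq_bigl (fun P : 'I_m.+1 * 'I_Q => xpredT P.1 && (P.1 * Q + P.2 *
  M <= m)%N)) //.
rewrite -(pair_big_dep xpredT (fun (i : 'I_m.+1) (j : 'I_Q) => (i * Q + j * M <= m)%N)
  (fun _ _ => 1%N)) /=.
rewrite (exchange_big_dep xpredT) //=.
transitivity (\sum_(j < Q | (j < a)%N) ((a.-1 - j) * M %/ Q).+1)%N.
  rewrite [RHS]big_mkcond; apply: eq_bigr => j _.
  have [lt_ja|le_aj] := ltnP j a; last first.
    rewrite big1 // => i le_m; have : (j * M <= m)%N := leq_trans (leq_addl _ _) le_m.
    rewrite leq_pmul2r // => le_j; have := leq_trans le_aj le_j.
    by rewrite subn1 -ltnS prednK // ltnn.
  set c := ((a.-1 - j) * M %/ Q)%N.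
  have le_cm : (c < m.+1)%N.
    rewrite ltnS (leq_trans (leq_div _ _)) // leq_mul2r; apply/orP; right.
    by move: a_gt0; clear; lia.
  rewrite (eq_bigl (fun i : 'I_m.+1 => (i < c.+1)%N)) => [|i].
    by rewrite -(big_ord_widen _ (fun _ => 1%N) le_cm) sum1_card card_ord.
  rewrite ltnS leq_divRL //.
  have le_jm : (j * M <= m)%N by rewrite leq_mul2r subn1 -ltnS prednK // lt_ja orbT.
  have -> : ((a.-1 - j) * M = m - j * M)%N by rewrite mulnBl subn1.
  by rewrite leq_subRL // addnC.
rewrite -(big_ord_widen Q (fun j => ((a.-1 - j) * M %/ Q).+1) a_leQ) (reindex_inj rev_ord_inj) /=.
apply: eq_bigr => i _; congr ((_ * _ %/ _).+1).
by have := ltn_ord i; move: (i : nat) => k; clear; lia.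
Qed.

(** [M = Q + B] with [B * (q - 1) = Q - 1]. *)
Lemma sum_floor_weights :
  (\sum_(i < a) ((i * M) %/ Q).+1 = (a * (a + 1)) %/ 2 +
     \sum_(1 <= i < a) (i * (Q - 1)) %/ (Q * (q - 1)))%N.
Proof.
have Q_gt0 : (0 < Q)%N by rewrite ltnW // expQ_gt1.
have le_QM : (Q <= M)%N.
  rewrite /trace_exp; case: n n_gt1 => // n' _; rewrite big_ord_recr /=; exact: leq_addl.
have floorE (i : nat) : ((i * M) %/ Q = i + (i * (Q - 1)) %/ (Q * (q - 1)))%N.
  rewrite -{1}(subnKC le_QM) mulnDr divnMDl //; congr (_ + _)%N.
  have q1_gt0 : (0 < q - 1)%N by rewrite subn_gt0.
  rewrite -(divnMr q1_gt0) -mulnA mulnBl trace_exp_mul; congr ((i * _) %/ _)%N.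
  have -> : (q ^ n = Q * q)%N by rewrite -expnSr prednK // ltnW.
  by rewrite mulnBr muln1; have : (Q <= Q * q)%N; [rewrite leq_pmulr // ltnW | clear; lia].
have tri : (\sum_(i < a) i.+1 = (a * (a + 1)) %/ 2)%N.
  have dbl k : ((\sum_(i < k) i.+1) * 2 = k * (k + 1))%N.
    by elim: k => [|k IH]; rewrite ?big_ord0 // big_ord_recr /= mulnDl IH; clear; lia.
  by rewrite -dbl mulnK.
rewrite (eq_bigr (fun i : 'I_a => i.+1 + (i * (Q - 1)) %/ (Q * (q - 1)))%N) => [|i _];
  last by rewrite floorE addSn.
rewrite big_split /= tri; congr (_ + _)%N.
rewrite -(big_mkord xpredT (fun i => (i * (Q - 1)) %/ (Q * (q - 1)))%N) big_ltn //.
by rewrite mul0n div0n add0n.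
Qed.
End Count.

(** * The code and its parameters *)

Section OnePointCode.
Variables (K : finFieldType) (p e n a : nat).
Local Notation q := (p ^ e)%N.
Hypotheses (p_pr : prime p) (q_gt1 : (1 < q)%N) (n_gt1 : (1 < n)%N).
Hypothesis cardK : #|K| = (q ^ n)%N.
Local Notation R := {poly {poly K}}.
Local Notation Q := (q ^ n.-1)%N.
Local Notation M := (trace_exp q n).
Hypotheses (a_gt1 : (1 < a)%N) (a_ltQ : (a < Q)%N).
Local Notation m := ((a - 1) * M)%N.
Local Notation N := (q ^ (2 * n - 1))%N.

Let a_gt0 : (0 < a)%N := ltnW a_gt1.
Let a_leQ : (a <= Q)%N := ltnW a_ltQ.
Let M_gt0 : (0 < M)%N := trace_exp_gt0 q n_gt1.
Let Q_gt0 : (0 < Q)%N := ltnW (expQ_gt1 q_gt1 n_gt1).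

Definition point (i : 'I_N) : K * K :=
  enum_val (cast_ord (esym (card_curve_points p_pr q_gt1 n_gt1 cardK)) i).

Lemma point_inj : injective point.
Proof. by move=> i j /enum_val_inj /cast_ord_inj. Qed.

Lemma point_curve i : trace_pow q n (point i).2 = (point i).1 ^+ M.
Proof. by have := enum_valP (cast_ord (esym (card_curve_points p_pr q_gt1 n_gt1 cardK)) i);
  rewrite inE => /eqP. Qed.

Lemma point_surj (P : K * K) : trace_pow q n P.2 = P.1 ^+ M -> exists i, point i = P.
Proof.
move=> curP; have PS : P \in curve_points K p e n by rewrite inE; apply/eqP.
exists (cast_ord (card_curve_points p_pr q_gt1 n_gt1 cardK) (enum_rank_in PS P)).
by rewrite /point cast_ordK enum_rankK_in.
Qed.

Lemma weight_lt_length : (m < N)%N.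
Proof.
have le_MQ : (M <= q * Q)%N.
  rewrite -expnS prednK ?(ltnW n_gt1) //.
  have le_M : (M <= M * (q - 1))%N by rewrite leq_pmulr // subn_gt0.
  by rewrite trace_exp_mul in le_M; apply: leq_trans le_M (leq_subr _ _).
have -> : N = (Q * (q * Q))%N.
  by rewrite -expnS -expnD; congr (_ ^ _)%N; move: n_gt1; clear; lia.
apply: (@leq_ltn_trans ((a - 1) * (q * Q))%N); first by rewrite leq_mul2l le_MQ orbT.
rewrite ltn_pmul2r ?muln_gt0 ?Q_gt0 ?(ltnW q_gt1) //.
by move: a_gt0 a_ltQ; clear; lia.
Qed.

Local Notation I := (monomial_exps q n a).
Definition monomial (ij : 'I_m.+1 * 'I_Q) : R := ('X^(ij.1))%:P * 'X^(ij.2).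

Definition poly_of_row (u : 'rV[K]_#|I|) : R :=
  \sum_(t < #|I|) (u 0 t)%:P%:P * monomial (enum_val t).

Lemma coef_poly_of_row (u : 'rV[K]_#|I|) (t : 'I_#|I|) : (poly_of_row u)`_((enum_val
  t).2)`_((enum_val t).1) = u 0 t.
Proof.
rewrite /poly_of_row !coef_sum (bigD1 t) //= /monomial.
rewrite mulrA -polyCM coefCM coefXn eqxx mulr1 coefCM coefXn eqxx mulr1.
rewrite big1 ?addr0 // => s nest; rewrite mulrA -polyCM coefCM coefXn.
case: eqP => [eq2|]; last by rewrite mulr0 coef0.
rewrite mulr1 coefCM coefXn; case: eqP => [eq1|]; last by rewrite mulr0.
case/eqP: nest; apply: enum_val_inj; move: eq1 eq2.
by case: (enum_val s) (enum_val t) => [? ?] [? ?] /= /val_inj -> /val_inj ->.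
Qed.

Lemma poly_of_row_spec u : (size (poly_of_row u) <= Q)%N /\ weight_le q n m (poly_of_row u).
Proof.
split.
  apply: (leq_trans (size_sum _ _ _)); apply/bigmax_leqP => t _.
  rewrite mulrA -polyCM (leq_trans (size_polyMleq _ _)) // size_polyXn addnS /=.
  by rewrite (leq_trans (leq_add (size_polyC_leq1 _) (leqnn _))) // add1n.
rewrite /poly_of_row; elim/big_ind: _ => [|u1 u2 l1 l2|t _].
- exact: weight_le0.
- exact: (weight_leD l1 l2).
have lt : weight_le q n m (monomial (enum_val t)).
  have := enum_valP t; rewrite inE => /weight_le_trans; apply.
  exact: (weight_monomial K q n _ _).1.
by have := weight_leM (weight_le_const q n (u 0 t)) lt; rewrite add0n.
Qed.

Lemma poly_of_row_surj (b : R) : (size b <= Q)%N -> weight_le q n m b ->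
  exists u, b = poly_of_row u.
Proof.
move=> szb lb; pose u : 'rV[K]_#|I| := \row_(t < #|I|) b`_((enum_val (t :
  'I_#|I|)).2)`_((enum_val t).1).
exists u; have [szu lu] := poly_of_row_spec u.
apply/polyP => j; apply/polyP => i.
have [szj|lt_jQ] := leqP Q j.
  by rewrite !(nth_default _ (leq_trans _ szj)).
have [le_m|nle] := boolP (i * Q + j * M <= m)%N; last first.
  have zero (c : R) : weight_le q n m c -> c`_j`_i = 0.
    move=> /((@weight_leP K q n n_gt1 m c).1)/(_ i j) le_c.
    by apply/eqP; apply: contraNT nle => /le_c.
  by rewrite !zero.
have lt_im : (i < m.+1)%N.
  by rewrite ltnS; apply: leq_trans le_m; rewrite -[X in (X <= _)%N]muln1 (leq_trans _
    (leq_addr _ _)) // leq_mul2l Q_gt0 orbT.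
have ijI : (Ordinal lt_im, Ordinal lt_jQ) \in I by rewrite inE.
have := coef_poly_of_row u (enum_rank_in ijI (Ordinal lt_im, Ordinal lt_jQ)).
by rewrite mxE enum_rankK_in //= => ->.
Qed.

Definition gen_mx : 'M[K]_(#|I|, N) := \matrix_(t < #|I|) eval_row point (monomial (enum_val t)).

Lemma eval_poly_of_row u : eval_row point (poly_of_row u) = u *m gen_mx.
Proof.
apply/rowP => i; rewrite !mxE /eval_at eval2_sum; apply: eq_bigr => t _.
by rewrite eval2M eval2CC !mxE.
Qed.

Definition point_code : {vspace 'rV[K]_N} := limg (linfun (mulmxr gen_mx)).

Lemma point_codeP w : reflect (exists u : 'rV[K]_#|I|, w = u *m gen_mx) (w \in point_code).
Proof.
apply: (iffP memv_imgP) => [[u _ ->]|[u ->]]; exists u; rewrite ?memvf // lfunE //.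
Qed.

Lemma card_zeros_le (b : R) : (size b <= Q)%N -> weight_le q n m b -> b != 0 ->
  (#|[set i | eval_at point i b == 0%R]| <= m)%N.
Proof.
move=> szb lb nzb; have [l [lbl nzl]] := reduced_lead_form q_gt1 n_gt1 szb nzb.
apply: leq_trans (lead_form_unique_le lb nzl).
apply: (@zeros_le_weight K q n q_gt1 n_gt1 _ (fun k => point (enum_val k)) _ b) => //.
- by move=> k; apply: point_curve.
- by move=> k k' /point_inj/enum_val_inj.
- by move=> k; have := enum_valP k; rewrite inE => /eqP.
Qed.

(** A nonzero function of weight at most [m] has at most [m] zeros, fewer than there are
    points. *)
Lemma gen_mx_inj (u : 'rV[K]_#|I|) : u *m gen_mx = 0 -> u = 0.
Proof.
move=> u0; have [szu lu] := poly_of_row_spec u.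
have [pu0|nzp] := eqVneq (poly_of_row u) 0.
  by apply/rowP => t; rewrite -coef_poly_of_row pu0 !coef0 mxE.
have := card_zeros_le szu lu nzp; rewrite leqNgt.
have -> : [set i | eval_at point i (poly_of_row u) == 0] = [set: 'I_N]%SET.
  apply/setP => i; rewrite !inE; have := congr1 (fun w : 'rV[K]_N => w 0 i) u0.
  by rewrite -eval_poly_of_row !mxE => ->; rewrite eqxx.
by rewrite cardsT card_ord weight_lt_length.
Qed.

Lemma dim_point_code : \dim point_code = #|I|.
Proof.
rewrite /point_code limg_dim_eq ?dimvf /=; first by rewrite /dim /= mul1n.
apply/eqP; rewrite -subv0; apply/subvP => u; rewrite memv_cap memvf memv_ker lfunE /=.
by move=> /eqP/gen_mx_inj ->; apply: mem0v.
Qed.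

Lemma hamming_dist_zeros (u v : 'rV[K]_N) (b : R) : u - v = eval_row point b ->
  hamming_dist u v = (N - #|[set i | eval_at point i b == 0%R]|)%N.
Proof.
move=> uvE; rewrite /hamming_dist cardsCs card_ord; congr (_ - _)%N.
apply: eq_card => i; rewrite !inE negbK -subr_eq0.
by have := congr1 (fun w : 'rV[K]_N => w 0 i) uvE; rewrite !mxE => ->.
Qed.

(** The lines [y = c] with [c] of nonzero trace meet the curve in [M] rational points each
    by [card_norm_fiber]; a product of [a - 1] of them has weight [m] and [m] zeros. *)
Lemma extremal_poly : exists b : R,
  [/\ (size b <= Q)%N, weight_le q n m b, b != 0
    & (m <= #|[set i | eval_at point i b == 0%R]|)%N].
Proof.
pose S0 := [set c : K | trace_pow q n c != 0].
(* The complement of the trace-zero elements has [q * Q - Q >= Q] elements. *)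
have cardS0 : (a - 1 <= #|S0|)%N.
  rewrite cardsCs; have -> : ~: S0 = [set c | trace_pow q n c == 0].
    by apply/setP => c; rewrite !inE negbK.
  rewrite (card_trace_fiber p_pr q_gt1 n_gt1 cardK) ?expr0n ?gtn_eqF ?(ltnW q_gt1) // cardK.
  have -> : (q ^ n = q * Q)%N by rewrite -expnS prednK // ltnW.
  have : (2 * Q <= q * Q)%N by rewrite leq_mul2r q_gt1 orbT.
  by move: (q * Q)%N a_ltQ; clear; lia.
pose s := take (a - 1) (enum S0).
have szs : size s = (a - 1)%N by rewrite size_takel // -cardE.
have uniq_s : uniq s by rewrite take_uniq // enum_uniq.
have s_trace c : c \in s -> trace_pow q n c != 0.
  by move=> /mem_take; rewrite mem_enum inE.
pose b : R := \prod_(c <- s) ('X - c%:P%:P).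
have wb (r : seq K) : weight_le q n (size r * M) (\prod_(c <- r) ('X - c%:P%:P) : R).
  elim: r => [|c r IH].
    by rewrite big_nil mul0n; have := weight_le_const q n (1 : K); rewrite !polyC1.
  rewrite big_cons /= mulSn; apply: weight_leM => //; apply: weight_leB.
    have := (weight_monomial K q n 0 1).1.
    by rewrite expr0 polyC1 mul1r expr1 mul0n add0n mul1n.
  exact: weight_le_trans (weight_le_const q n c).
have szb : size b = a.
  by rewrite /b -(big_map (fun c : K => c%:P) xpredT (fun c => 'X - c%:P))
    size_prod_XsubC size_map szs subn1 prednK.
exists b; split; first by rewrite szb.
- by rewrite -szs.
- by rewrite -size_poly_eq0 szb -lt0n.
have bE i : eval_at point i b = \prod_(c <- s) ((point i).2 - c).
  rewrite /eval_at /b.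
  rewrite (rmorph_prod (eval2 idfun (point i).1 (point i).2 : {rmorphism R -> K})) /=.
  by apply: eq_bigr => c _; rewrite eval2B eval2X eval2CC.
have -> : (a - 1)%N = #|s| by rewrite -szs; apply/esym/card_uniqP.
pose S1 := [set P : K * K | (P.2 \in s) && (P.1 ^+ M == trace_pow q n P.2)].
have <- : #|S1| = (#|s| * M)%N.
  rewrite -sum1dep_card.
  rewrite (reindex_inj (h := fun P : K * K => (P.2, P.1))) /=; last by move=> [? ?] [? ?] [-> ->].
  rewrite -(pair_big_dep (fun y => y \in s) (fun y x => x ^+ M == trace_pow q n y) (fun _
    _ => 1%N)) /=.
  rewrite -sum_nat_const; apply: eq_bigr => c /s_trace nz; rewrite sum1dep_card.
  have := card_norm_fiber q_gt1 n_gt1 cardK nz (trace_expq p_pr cardK c).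
  by move=> E; rewrite -[RHS]E; apply: eq_card => x; rewrite !inE.
have sub : S1 \subset point @: [set i | eval_at point i b == 0].
  apply/fintype.subsetP => P; rewrite inE => /andP[sP /eqP curP].
  have [i iP] := point_surj (esym curP); apply/imsetP; exists i => //.
  rewrite inE bE iP; apply/eqP/eqP; rewrite prodf_seq_eq0.
  by apply/hasP; exists P.2; rewrite // subrr eqxx.
exact: leq_trans (subset_leq_card sub) (leq_imset_card _ _).
Qed.

Lemma point_code_parameters : code_parameters point_code
  ((a * (a + 1)) %/ 2 + \sum_(1 <= i < a) (i * (Q - 1)) %/ (Q * (q - 1)))%N
  (N - m)%N.
Proof.
split.
  by rewrite dim_point_code (card_monomials_weight q_gt1 n_gt1 a_gt0 a_leQ)
    (sum_floor_weights q_gt1 n_gt1 a_gt0).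
have lower u v : u \in point_code -> v \in point_code -> u != v -> (N - m <= hamming_dist u v)%N.
  move=> /point_codeP[u1 ->] /point_codeP[v1 ->] neuv.
  have [szb lb] := poly_of_row_spec (u1 - v1).
  have uvE : u1 *m gen_mx - v1 *m gen_mx = eval_row point (poly_of_row (u1 - v1)).
    by rewrite eval_poly_of_row mulmxBl.
  rewrite (hamming_dist_zeros uvE) leq_sub2l // card_zeros_le //.
  apply: contra neuv => /eqP b0; rewrite -subr_eq0 uvE b0; apply/eqP/rowP => i.
  by rewrite !mxE /eval_at eval2_0.
split=> //; have [b [szb lb nzb zb]] := extremal_poly.
have [u bE] := poly_of_row_surj szb lb.
have uE : u *m gen_mx - 0 = eval_row point b by rewrite subr0 bE eval_poly_of_row.
have u_code : u *m gen_mx \in point_code by apply/point_codeP; exists u.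
have nzu : u *m gen_mx != 0.
  apply: contraNneq nzb => /gen_mx_inj u0; rewrite bE u0 /poly_of_row big1 // => t _.
  by rewrite mxE !polyC0 mul0r.
exists (u *m gen_mx), 0; split=> //; first exact: mem0v.
apply/eqP; rewrite eqn_leq lower ?mem0v // andbT (hamming_dist_zeros uE).
by rewrite leq_sub2l.
Qed.
End OnePointCode.

Section NormTraceAGCode.
Variables (K : finFieldType) (p e n a : nat).
Local Notation q := (p ^ e)%N.
Hypotheses (p_pr : prime p) (q_gt1 : (1 < q)%N) (n_gt1 : (1 < n)%N).
Hypothesis cardK : #|K| = (q ^ n)%N.
Local Notation R := {poly {poly K}}.
Local Notation Q := (q ^ n.-1)%N.
Local Notation M := (trace_exp q n).
Hypotheses (a_gt1 : (1 < a)%N) (a_ltQ : (a < Q)%N).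
Local Notation m := ((a - 1) * M)%N.
Local Notation N := (q ^ (2 * n - 1))%N.
Local Notation pt := (point p_pr q_gt1 n_gt1 cardK).

Variables (F : functionField K) (x y : F).
Hypothesis model : curve_model q n (ff_const F) x y.
Local Notation ev := (eval2 (ff_const F) x y).

Lemma rational_point_place (i : 'I_N) : exists P : place F,
  [/\ rational_place P, x \in place_ring P
    & forall b : R, place_eval P (ev b) = eval_at pt i b].
Proof.
have [ev_h ev_ker ev_frac] := model.
have cur := point_curve p_pr q_gt1 n_gt1 cardK i.
have e_gt0 : (0 < e)%N by move: q_gt1; case: e => //; rewrite expn0.
have m_gt0 : (0 < e * n * 1)%N by rewrite !muln_gt0 e_gt0 ltnW.
have Ks (c : K) : c ^+ (p ^ (e * n * 1)) = c := expf_card_exp cardK c 1.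
have [P [ringP idealP _]] := @affine_place_exists K p e n F x y (pcharK p_pr cardK)
  q_gt1 n_gt1 model K idfun (pt i).1 (pt i).2 _ cur m_gt0 Ks (Ks _) (Ks _).
have evalP b : ev b - ff_const F (eval_at pt i b) \in place_ideal P.
  apply/idealP; exists (b - (eval_at pt i b)%:P%:P), 1.
  rewrite !eval2_1 oner_neq0 divr1 !eval2B !eval2CC /=; split=> //.
  by rewrite -/(eval_at pt i b) subrr.
exists P; split.
- apply: rational_placeP => z /ringP[b [c [nzc zE]]].
  exists (eval_at pt i b / eval_at pt i c); apply/idealP.
  exists (b - (eval_at pt i b / eval_at pt i c)%:P%:P * c), c.
  split=> //.
    by rewrite eval2B eval2M eval2CC /= -/(eval_at pt i c) divfK ?subrr.
  have nzec : ev c != 0.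
    apply: contraNneq nzc => /ev_ker[d ->].
    by rewrite eval2M eval2_curve cur subrr mulr0.
  by rewrite eval2B eval2M eval2CC mulrBl mulfK // zE.
- by apply/ringP; exists 'X%:P, 1; rewrite !eval2_1 oner_neq0 eval2CX divr1.
- by move=> b; apply: place_evalE.
Qed.

(** The divisor is [m] times the place at infinity.  A function without poles elsewhere is a
    polynomial in [x] and [y] by [affine_regular], and its pole order at infinity is its
    weight. *)
Lemma norm_trace_AG_code :
  one_point_AG_code (point_code a p_pr q_gt1 n_gt1 cardK).
Proof.
have [ev_h ev_ker ev_frac] := model.
have [Pinf [rat_inf pole_inf valinf]] := infinity_place_exists q_gt1 n_gt1 model.
have M_gt0 := trace_exp_gt0 q n_gt1.
have Q_gt1 := expQ_gt1 q_gt1 n_gt1.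
have x_pole : x \notin place_ring Pinf.
  apply/negP => Ox.
  have nzX : 'X%:P != 0 :> R by rewrite polyC_eq0 polyX_eq0.
  have szX : (size ('X%:P : R) <= Q)%N by rewrite (leq_trans (size_polyC_leq1 _)) // ltnW.
  have nzx : x != 0.
    rewrite -(eval2CX (ff_const F) x y); apply: (ev_polyC_neq0 q_gt1 n_gt1 ev_ker).
    by rewrite polyX_eq0.
  have := valuation_ge0 Ox nzx; rewrite -(eval2CX (ff_const F) x y) -[valuation _ _]addr0.
  move/(valinf 0%N _ szX nzX)/((@weight_leP K q n n_gt1 _ _).1)/(_ 1%N 0%N).
  rewrite coefC coefX oner_neq0 mul1n mul0n addn0 leqn0 => /(_ isT).
  by rewrite gtn_eqF // ltnW.
have [P Pspec] := choice rational_point_place.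
have neq_inf P' : x \in place_ring P' -> P' <> Pinf.
  by move=> Ox eqP'; move: x_pole; rewrite -eqP' Ox.
have finG : finite_set [set P' : place F | (if `[< P' = Pinf >] then m%:Z else 0) != 0]%classic.
  apply: (sub_finite_set _ (finite_set1 Pinf)) => P' /=.
  by case: asboolP => // _; rewrite eqxx.
pose G : divisor F := Divisor finG.
have G_inf : G Pinf = m%:Z by rewrite /G /=; case: asboolP.
have G_other P' : P' <> Pinf -> G P' = 0 by rewrite /G /=; case: asboolP.
have m_neq0 : m != 0%N.
  by rewrite muln_eq0 negb_or subn_eq0 -ltnNge a_gt1 -lt0n.
have suppG : divisor_support G = [set Pinf]%classic.
  apply/seteqP; split=> P' /=; rewrite /divisor_support /=.
    by case: asboolP => // _; rewrite eqxx.
  by move=> ->; case: asboolP.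
have evalE (b : R) : eval_row pt b = \row_(i < N) place_eval (P i) (ev b).
  by apply/rowP => i; rewrite !mxE; have [_ _ ->] := Pspec i.
exists F, P, G; split; first by exists Pinf.
split.
- move=> i j eqP'; apply: (@point_inj K p e n p_pr q_gt1 n_gt1 cardK).
  have [_ _ evi] := Pspec i; have [_ _ evj] := Pspec j.
  have E b : eval_at pt i b = eval_at pt j b by rewrite -evi -evj eqP'.
  have := E 'X%:P; have := E 'X; rewrite /eval_at !eval2X !eval2CX.
  by case: (pt i) (pt j) => [? ?] [? ?] /= -> ->.
- by move=> i; have [] := Pspec i.
- move=> i; rewrite suppG /=; apply: neq_inf; by have [_ Ox _] := Pspec i.
move=> w; split=> [/point_codeP[u ->]|[f Lf ->]].
  have [szb lb] := poly_of_row_spec u; set b := poly_of_row u in szb lb.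
  exists (ev b); last by rewrite -evalE eval_poly_of_row.
  have [b0|nzb] := eqVneq b 0; first by left; rewrite b0 eval2_0.
  right=> P'; have [->|neP'] := pselect (P' = Pinf).
    by rewrite G_inf; apply/valinf.
  rewrite (G_other _ neP'); move: neP'.
  have nzeb : ev b != 0.
    by apply: contraNneq nzb => /(ev_reduced_eq0 q_gt1 n_gt1 ev_ker szb) ->.
  move=> /pole_inf Ox; rewrite addr0; apply: valuation_ge0 => //.
  have Oy : y \in place_ring P'.
    by rewrite -(pole_x_iff_y P' q_gt1 n_gt1 (model_curve model)).
  rewrite eval2E; apply: place_ring_sum => j _; apply: place_ringM; last exact: place_ringX.
  rewrite horner_coef; apply: place_ring_sum => k _; apply: place_ringM; last exact: place_ringX.
  by rewrite coef_map; apply: place_ring_const.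
have [b szb fE] : exists2 b : R, (size b <= Q)%N & f = ev b.
  apply: (affine_regular p_pr q_gt1 n_gt1 cardK model) => P' Ox nzf.
  case: Lf => [f0|/(_ P')]; first by rewrite f0 eqxx in nzf.
  by rewrite G_other ?addr0 //; apply: neq_inf.
have lb : weight_le q n m b.
  have [b0|nzb] := eqVneq b 0; first by rewrite b0; apply: weight_le0.
  apply/(valinf m b szb nzb); rewrite -fE -G_inf.
  case: Lf => [f0|]; last by apply.
  by case/eqP: nzb; apply: (ev_reduced_eq0 q_gt1 n_gt1 ev_ker szb); rewrite -fE.
have [u bE] := poly_of_row_surj q_gt1 n_gt1 szb lb.
by apply/point_codeP; exists u; rewrite fE -evalE bE eval_poly_of_row.
Qed.
End NormTraceAGCode.

Theorem corollary5p4 (q n : nat) (hq : prime_power q) (hq3 : (3 <= q)%N)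
    (hn : (2 <= n)%N) (K : finFieldType) (hK : #|K| = (q ^ n)%N)
    (a : nat) (ha : (2 <= a <= q ^ (n - 1) - 1)%N) :
  exists C : {vspace 'rV[K]_(q ^ (2 * n - 1))},
    one_point_AG_code C /\
    code_parameters C
      ((a * (a + 1)) %/ 2 +
       \sum_(1 <= i < a)
         (i * (q ^ (n - 1) - 1)) %/ (q ^ (n - 1) * (q - 1)))%N
      (q ^ (2 * n - 1) - ((a - 1) * (q ^ n - 1)) %/ (q - 1))%N.
Proof.
case: hq => p [e [p_pr e_gt0 qE]]; subst q.
have q_gt1 : (1 < p ^ e)%N by apply: leq_trans hq3.
have /andP[a_gt1 le_a] := ha.
have a_ltQ : (a < (p ^ e) ^ n.-1)%N.
  rewrite -subn1 -ltnS -subn_gt0; move: a_gt1 le_a; move: (_ ^ (n - 1))%N => c.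
  by clear; lia.
have [F [x [y model]]] := norm_trace_function_field K q_gt1 hn.
exists (point_code a p_pr q_gt1 hn hK); split.
  exact: (norm_trace_AG_code p_pr q_gt1 hn hK a_gt1 model).
have -> : (((a - 1) * ((p ^ e) ^ n - 1)) %/ (p ^ e - 1) = (a - 1) * trace_exp (p ^ e) n)%N.
  by rewrite -trace_exp_mul mulnA mulnK // subn_gt0.
by have := point_code_parameters p_pr q_gt1 hn hK a_gt1 a_ltQ; rewrite -(subn1 n).
Qed.
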